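(* Let $X$ be a real-valued random variable whose law $\mu$ satisfies Assumption 1 with parameters $h,w\in(0,1]$. Let $k\ge 3$ be an integer such that $$\mathbb{E}[X^j]=\int_{-\infty}^{\infty}u^j\,\frac{e^{-u^2/2}}{\sqrt{2\pi}}\,\mathrm{d}u\qquad\text{for } j=1,\ldots,k,$$ and suppose that $\mathbb{E}[|X|^{k+1}]<\infty$. Let $N\ge 1$ be an integer and let $X_1,\ldots,X_N$ be independent random variables, each distributed like $X$. Let $G$ be a standard Gaussian random variable. Then $$\mathrm{d}_{\mathrm{KS}}\left(\frac{X_1+\cdots+X_N}{\sqrt N},\,G\right)\le 3\left\{\frac{\mathbb{E}[|X|^{k+1}]}{N^{\frac{k-1}{2}}}+\exp\left(-\frac{1}{160}\,\frac{h w^3 N}{\mathbb{E}[|X|^{k+1}]}\right)\right\}.$$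
   Context: For real-valued random variables $Y,Z$, the Kolmogorov-Smirnov distance is $\mathrm{d}_{\mathrm{KS}}(Y,Z):=\sup_{s\in\mathbb{R}}|\mathbb{P}(Y\le s)-\mathbb{P}(Z\le s)|$. Assumption 1 (with parameters $h,w$, where $0<h\le 1$ and $0<w\le 1$) on a probability measure $\mu$ on $\mathbb{R}$: write $\mu=\mu_d+\mu'$ for the Lebesgue decomposition, with $\mu_d$ absolutely continuous with respect to Lebesgue measure and $\mu'$ singular, and let $f:\mathbb{R}\to[0,\infty)$ be the density of $\mu_d$. Then there is some $a\in\mathbb{R}$ such that $f(s)\ge h$ for all $s\in[a,a+w)$. *)

(* Defs.v *)
From HB Require Import structures.
From mathcomp Require Import all_boot all_order all_algebra.
From mathcomp Require Import all_classical all_reals all_analysis.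
From mathcomp Require Import measurable_realfun.

Set Implicit Arguments.
Unset Strict Implicit.
Unset Printing Implicit Defensive.

Import Order.TTheory GRing.Theory Num.Theory.
Import numFieldNormedType.Exports.

Local Open Scope classical_set_scope.
Local Open Scope ring_scope.

Section measures.
Context {R : realType}.
Implicit Types mu : set (measurableTypeR R) -> \bar R.

Definition mutually_singular d (T : measurableType d) (m1 m2 : set T -> \bar R) :=
  exists A, [/\ measurable A, m1 A = 0%E & m2 (~` A) = 0%E].

Definition lebesgue_decomposition mu
    (mud mus : {measure set (measurableTypeR R) -> \bar R}) :=
  [/\ forall A, measurable A -> mu A = (mud A + mus A)%E,
      mud `<< (@lebesgue_measure R)
    & mutually_singular mus (@lebesgue_measure R)].

Definition is_density mu (f : measurableTypeR R -> R) :=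
  [/\ measurable_fun setT f, forall s, 0 <= f s
    & forall A, measurable A ->
        mu A = (\int[@lebesgue_measure R]_(s in A) (f s)%:E)%E].

(* A density is only determined almost everywhere, so the lower bound is
   required of some version of it. *)
Definition assumption1 (h w : R) mu :=
  exists mud mus f,
    [/\ lebesgue_decomposition mu mud mus, is_density mud f
      & exists a : R, forall s, a <= s < a + w -> h <= f s].

End measures.

Section random_variables.
Context {R : realType}.

(* Laws are compared on measurable sets only: the value of a measure outside
   the sigma-algebra is meaningless. *)
Definition has_law d (T : measurableType d) (P : probability T R)
    (X : {RV P >-> R}) (mu : set (measurableTypeR R) -> \bar R) :=
  forall A, measurable A -> distribution P X A = mu A.

Definition mutually_independent d (T : measurableType d) (P : probability T R)
    (I : finType) (X : I -> {RV P >-> R}) :=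
  forall (J : {set I}) (B : I -> set R),
    (forall i, measurable (B i)) ->
    P (\bigcap_(i in [set` J]) (X i @^-1` B i)) =
    (\prod_(i in J) P (X i @^-1` B i))%E.

Section normalized_sum.
Context d (T : measurableType d) (P : probability T R) (N : nat).
Variable X : 'I_N -> {RV P >-> R}.

Definition normalized_sum (t : T) : R := (\sum_(i < N) X i t) / Num.sqrt N%:R.

Lemma measurable_normalized_sum : measurable_fun setT normalized_sum.
Proof.
apply: measurable_funM => //.
by apply: measurable_sum => i; exact: measurable_funPT.
Qed.

HB.instance Definition _ :=
  isMeasurableFun.Build _ _ _ _ normalized_sum measurable_normalized_sum.

End normalized_sum.

(* The two variables may live on different probability spaces. *)
Definition dKS d1 (T1 : measurableType d1) (P1 : probability T1 R)
    d2 (T2 : measurableType d2) (P2 : probability T2 R)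
    (Y : {RV P1 >-> R}) (Z : {RV P2 >-> R}) : \bar R :=
  ereal_sup (range (fun s : R => `|cdf Y s - cdf Z s|%E)).

End random_variables.

Arguments has_law {R d T} P X mu.
Arguments mutually_independent {R d T} P {I} X.
Arguments normalized_sum {R d T} P {N} X t.
Arguments dKS {R d1 T1} P1 {d2 T2} P2 Y Z.

(* Main.v *)
From HB Require Import structures.
Require Import Defs.
From mathcomp Require Import all_boot all_order all_algebra.
From mathcomp Require Import all_classical all_reals all_analysis.
From mathcomp Require Import measurable_realfun.
From mathcomp Require Import ring lra.

(** The distance between the distribution functions of the normalized sum and
    of the Gaussian law is controlled by the difference of their characteristic
    functions.  The law of X may have a singular part, so the characteristic
    function of the sum need not be integrable at infinity; both laws are first
    convolved with a Cauchy law of tiny scale sig, whose distribution function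
    1/2 + atan (y / sig) / pi is the Fourier integral of
    sin (t y) exp (- sig t) / t over t > 0 ([atan_sinc_kernel]).  By Fubini the
    smoothed distribution functions differ by at most 1/pi times the integral of
    exp (- sig t) / t against the difference of the characteristic functions
    ([smoothed_diff_le]), and removing the smoothing costs a Cauchy tail plus a
    small Gaussian increment ([cdf_diff_le]).

    Complex numbers are avoided: a characteristic function is recorded by its
    phases E cos (th + t Y), a trigonometric polynomial rho cos (th + phi) in
    th.  Summing N independent copies raises rho to the power N and multiplies
    phi by N ([phase_cf_sum]).

    Write M for the moment of order k + 1 of |X|, L for h w^3 N / M, and
    s = t / sqrt N for the frequency seen by one summand.

    Low frequencies, s^2 M <= 1.  As k moments agree, Taylor expansion bounds
    the difference of the two characteristic functions at s by s^(k+1) M / k!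
    ([phase_cf_gauss_diff]), and both have modulus at most exp (- 11 s^2 / 24)
    ([phase_cf_low]); telescoping the N-th powers gives the bound
    M N^(-(k-1)/2) (t^(k+1) / k!) exp (- 2 t^2 / 5) of [cf_power_low], whose
    contribution is a multiple of M N^(-(k-1)/2).

    High frequencies, s^2 M >= 1.  The law of X dominates h times Lebesgue
    measure on an interval of length w, and the Fourier transform of a uniform
    law is bounded away from 1 there, so the characteristic function of X has
    modulus at most 1 - h w^3 / (48 M) ([phase_cf_high]).  Its N-th power is at
    most exp (- L / 48), which leaves enough room below exp (- L / 160) to
    afford a smoothing scale of order exp (- L / 80): the loss exp (L / 80) in
    the integral over high frequencies and the smoothing error exp (- L / 160)
    are both absorbed ([cdf_bound_of_small_error]).  When
    exp (- L / 160) >= 1 / 3 the claimed bound exceeds 1. *)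

Set Implicit Arguments.
Unset Strict Implicit.
Unset Printing Implicit Defensive.

Import Order.TTheory GRing.Theory Num.Theory.
Import numFieldNormedType.Exports.

Local Open Scope classical_set_scope.
Local Open Scope ring_scope.

(** * Derivation rules for expressions with a bound variable *)

Section derivation_rules.
Context {R : realType}.
Implicit Types (f g : R -> R) (x a b : R).

(** Derivatives are computed mechanically by [der] and then identified;
    [is_derive] being a class, instance search would otherwise pick another
    shape for them. *)
Lemma is_derive_congr f x a b : is_derive x (1 : R) f a -> a = b -> is_derive x (1 : R) f b.
Proof. by move=> ? <-. Qed.

Lemma drv_cst c x : is_derive x (1 : R) (fun=> c) (0 : R).
Proof. exact: is_derive_cst. Qed.

Lemma drv_id x : is_derive x (1 : R) (fun y : R => y) 1.
Proof. exact: is_derive_id. Qed.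

Lemma drv_D f g x a b : is_derive x (1 : R) f a -> is_derive x (1 : R) g b ->
  is_derive x (1 : R) (fun y => f y + g y) (a + b).
Proof. by move=> ? ?; exact: is_deriveD. Qed.

Lemma drv_N f x a : is_derive x (1 : R) f a ->
  is_derive x (1 : R) (fun y => - f y) (- a).
Proof. by move=> ?; exact: is_deriveN. Qed.

Lemma drv_M f g x a b : is_derive x (1 : R) f a -> is_derive x (1 : R) g b ->
  is_derive x (1 : R) (fun y => f y * g y) (f x * b + g x * a).
Proof. by move=> ? ?; exact: is_deriveM. Qed.

Lemma drv_X f n x a : is_derive x (1 : R) f a ->
  is_derive x (1 : R) (fun y => f y ^+ n) (n%:R * f x ^+ n.-1 * a).
Proof.
move=> dfx; have -> : (fun y => f y ^+ n) = f ^+ n.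
  by apply/funext => y; rewrite fctE.
exact: is_deriveX.
Qed.

Lemma drv_comp (u : R -> R) f x a b :
  is_derive x (1 : R) f a -> is_derive (f x) (1 : R) u b ->
  is_derive x (1 : R) (fun y => u (f y)) (b * a).
Proof. by move=> ? ?; exact: (@is_derive1_comp _ u f). Qed.

Lemma drv_exp f x a : is_derive x (1 : R) f a ->
  is_derive x (1 : R) (fun y => expR (f y)) (expR (f x) * a).
Proof. by move=> d; apply: drv_comp. Qed.

Lemma drv_cos f x a : is_derive x (1 : R) f a ->
  is_derive x (1 : R) (fun y => cos (f y)) (- sin (f x) * a).
Proof. by move=> d; apply: drv_comp. Qed.

Lemma drv_sin f x a : is_derive x (1 : R) f a ->
  is_derive x (1 : R) (fun y => sin (f y)) (cos (f x) * a).
Proof. by move=> d; apply: drv_comp. Qed.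

Lemma drv_atan f x a : is_derive x (1 : R) f a ->
  is_derive x (1 : R) (fun y => atan (f y)) ((1 + f x ^+ 2)^-1 * a).
Proof. by move=> d; apply: drv_comp. Qed.

Lemma drv_inv f x a : f x != 0 -> is_derive x (1 : R) f a ->
  is_derive x (1 : R) (fun y => (f y)^-1) (- (f x) ^- 2 * a).
Proof.
move=> fx0 d; exact: is_deriveV fx0 d.
Qed.

End derivation_rules.

Ltac der := lazymatch goal with
  | |- is_derive _ _ (fun _ => ?c) _ => exact (drv_cst _ _)
  | |- is_derive _ _ (fun y => y) _ => exact (drv_id _)
  | |- is_derive _ _ (fun y => @?f y + @?g y) _ =>
      notypeclasses refine (@drv_D _ f g _ _ _ _ _); der
  | |- is_derive _ _ (fun y => - @?f y) _ =>
      notypeclasses refine (@drv_N _ f _ _ _); der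
  | |- is_derive _ _ (fun y => @?f y * @?g y) _ =>
      notypeclasses refine (@drv_M _ f g _ _ _ _ _); der
  | |- is_derive _ _ (fun y => @?f y ^+ ?n) _ =>
      notypeclasses refine (@drv_X _ f n _ _ _); der
  | |- is_derive _ _ (fun y => expR (@?f y)) _ =>
      notypeclasses refine (@drv_exp _ f _ _ _); der
  | |- is_derive _ _ (fun y => cos (@?f y)) _ =>
      notypeclasses refine (@drv_cos _ f _ _ _); der
  | |- is_derive _ _ (fun y => sin (@?f y)) _ =>
      notypeclasses refine (@drv_sin _ f _ _ _); der
  | |- is_derive _ _ (fun y => atan (@?f y)) _ =>
      notypeclasses refine (@drv_atan _ f _ _ _); der
  | _ => eassumption
  end.

Ltac derive_eq := notypeclasses refine (is_derive_congr _ _); [by der|].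

(** * Taylor expansion of the cosine *)

Section taylor.
Context {R : realType}.
Implicit Types (f : R -> R) (x th : R).

Lemma ge0_of_derive_ge0 (f f' : R -> R) (x : R) :
  (forall y : R, is_derive y 1 f (f' y)) -> f 0 = 0 -> 0 <= x ->
  (forall y, 0 <= y -> 0 <= f' y) -> 0 <= f x.
Proof.
move=> df f0; rewrite le_eqVlt => /predU1P[<-|x0] f'0; first by rewrite f0.
have cf : {within `[0, x], continuous f}.
  apply: derivable_within_continuous => y _.
  by have [] := df y.
have [c /[!in_itv]/= /andP[c0 _] E] := MVT x0 (fun y _ => df y) cf.
by move: E; rewrite f0 !subr0 => ->; apply: mulr_ge0; [exact/f'0/ltW|exact: ltW].
Qed.

(** The induction step of Taylor's inequality. The difference between x^(n+1)
    / (n+1)! and f is monotone on x >= 0; the three other sign cases follow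
    by replacing f by its opposite or by its reflection. *)
Lemma norm_le_pow_primitive (f f' : R -> R) (n : nat) :
  (forall y : R, is_derive y 1 f (f' y)) -> f 0 = 0 ->
  (forall y, `|f' y| <= `|y| ^+ n / n`!%:R) ->
  forall x, `|f x| <= `|x| ^+ n.+1 / n.+1`!%:R.
Proof.
have pos (g g' : R -> R) : (forall y : R, is_derive y 1 g (g' y)) -> g 0 = 0 ->
    (forall y, `|g' y| <= `|y| ^+ n / n`!%:R) ->
    forall x, 0 <= x -> g x <= x ^+ n.+1 / n.+1`!%:R.
  move=> dg g0 gn x x0; rewrite -subr_ge0.
  pose h := fun y : R => y ^+ n.+1 / n.+1`!%:R - g y.
  rewrite -/(h x).
  apply: (@ge0_of_derive_ge0 h (fun y => y ^+ n / n`!%:R - g' y)) => //.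
  - move=> y.
    have := dg y => dgy.
    rewrite /h; derive_eq.
    rewrite /= mulr0 add0r mulr1 /= factS natrM invfM.
    have : n.+1%:R != 0 :> R by rewrite pnatr_eq0.
    have : n`!%:R != 0 :> R by rewrite pnatr_eq0 -lt0n fact_gt0.
    by move=> a b; field; rewrite a addrC natr1.
  - by rewrite /h g0 expr0n/= mul0r subr0.
  - move=> y y0; rewrite subr_ge0 (le_trans (ler_norm _))// (le_trans (gn y))//.
    by rewrite ger0_norm.
move=> df f0 fn x.
have dN (g g' : R -> R) : (forall y : R, is_derive y 1 g (g' y)) ->
    forall y : R, is_derive y 1 (fun z => - g z) (- g' y).
  by move=> dg y; have := dg y => dgy; exact: drv_N.
have dNN (g g' : R -> R) : (forall y : R, is_derive y 1 g (g' y)) ->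
    forall y : R, is_derive y 1 (fun z => g (- z)) (- g' (- y)).
  move=> dg y; have dgy := dg (- y).
  apply: (is_derive_congr (@drv_comp _ g -%R y _ _ (drv_N (drv_id y)) dgy)).
  by rewrite mulrN1.
have [x0|x0] := leP 0 x.
  rewrite (ger0_norm x0) ler_norml lerNl; apply/andP; split.
  - apply: (pos (fun z => - f z) (fun z => - f' z)) => //.
    + by rewrite f0 oppr0.
    + by move=> y; rewrite normrN.
  - exact: (pos f f').
have Nx0 : 0 <= - x by rewrite oppr_ge0 ltW.
rewrite (ltr0_norm x0) ler_norml lerNl; apply/andP; split.
- have := pos (fun z => - f (- z)) (fun z => - - f' (- z)) _ _ _ (- x) Nx0.
  rewrite opprK; apply.
  + by rewrite oppr0 f0 oppr0.
  + by move=> y; rewrite opprK -(normrN y).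
- have := pos (fun z => f (- z)) (fun z => - f' (- z)) _ _ _ (- x) Nx0.
  rewrite opprK; apply.
  + by rewrite oppr0 f0.
  + by move=> y; rewrite normrN -(normrN y).
Qed.

(** Working with cos (th + x) for all phases th covers sine and cosine at
    once, since differentiation only shifts the phase by pi / 2. *)
Definition cos_taylor th (n : nat) x : R :=
  \sum_(j < n) cos (th + j%:R * (pi / 2)) / j`!%:R * x ^+ j.

Lemma cos_taylorS th n x :
  is_derive x 1 (cos_taylor th n.+1) (cos_taylor (th + pi / 2) n x).
Proof.
have -> : cos_taylor th n.+1 = (fun x => cos th +
    \sum_(j < n) cos (th + j.+1%:R * (pi / 2)) / j.+1`!%:R * x ^+ j.+1).
  apply/funext => y; rewrite /cos_taylor big_ord_recl/= mul0r addr0 fact0.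
  by rewrite expr0 divr1 mulr1.
have -> : (fun y : R => cos th + \sum_(j < n)
      cos (th + j.+1%:R * (pi / 2)) / j.+1`!%:R * y ^+ j.+1) =
   fun y => cos th + (\sum_(j < n) fun y =>
      cos (th + j.+1%:R * (pi / 2)) / j.+1`!%:R * y ^+ j.+1) y.
  by apply/funext => y; rewrite fct_sumE.
have dterm (j : 'I_n) : is_derive x (1 : R)
    (fun y => cos (th + j.+1%:R * (pi / 2)) / j.+1`!%:R * y ^+ j.+1)
    (cos (th + pi / 2 + j%:R * (pi / 2)) / j`!%:R * x ^+ j).
  derive_eq.
  rewrite /= mulr0 addr0 mulr1 factS natrM.
  have -> : th + j.+1%:R * (pi / 2) = th + pi / 2 + j%:R * (pi / 2).
    by rewrite -natr1; ring.
  have a : j.+1%:R != 0 :> R by rewrite pnatr_eq0.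
  have b : j`!%:R != 0 :> R by rewrite pnatr_eq0 -lt0n fact_gt0.
  by move: (cos _) => c; field; rewrite b addrC natr1 a.
apply: (is_derive_congr (drv_D (drv_cst _ _) (is_derive_sum dterm))).
by rewrite add0r.
Qed.

Lemma cos_taylor_bound n th x :
  `|cos (th + x) - cos_taylor th n x| <= `|x| ^+ n / n`!%:R.
Proof.
elim: n th x => [|n IH] th x.
  by rewrite /cos_taylor big_ord0 subr0 expr0 fact0 divr1 cos_max.
apply: (@norm_le_pow_primitive (fun x => cos (th + x) - cos_taylor th n.+1 x)
  (fun x => cos (th + pi / 2 + x) - cos_taylor (th + pi / 2) n x)).
- move=> y; have := cos_taylorS th n y => d1.
  derive_eq.
  by rewrite add0r mulr1 addrAC cosDpihalf.
- rewrite /cos_taylor big_ord_recl big1 => [|i _].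
    by rewrite /= fact0 expr0 mul0r !addr0 divr1 mulr1 subrr.
  by rewrite expr0n/= mulr0.
- by move=> y; exact: IH.
Qed.

End taylor.

(** * Integrals determined by their values on indicators *)

Section weighted_integral.
Local Open Scope ereal_scope.
Context {R : realType}.
Import HBNNSimple.

(** Both sides are monotone limits along the same simple functions
    approximating f, so the integral on the left only depends on the
    integrals of indicators. *)
Lemma weighted_integral_approx d d' (T : measurableType d)
    (T' : measurableType d') (m : {measure set T -> \bar R})
    (Y : T -> T') (p : T -> R) (f : T' -> R)
    (mf : measurable_fun setT (EFin \o f)) :
  measurable_fun setT Y -> measurable_fun setT p ->
  (forall x, 0 <= p x)%R -> (forall y, 0 <= f y)%R ->
  \int[m]_x (f (Y x) * p x)%:E =
  lim ((\sum_(r \in range (nnsfun_approx measurableT mf n))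
    (r%:E * \int[m]_x (\1_(nnsfun_approx measurableT mf n @^-1` [set r]) (Y x)
                        * p x)%:E)) @[n --> \oo]).
Proof.
move=> mY mp p0 f0.
set h := nnsfun_approx measurableT mf.
have mhY n : measurable_fun setT (fun x => h n (Y x) * p x)%R.
  by apply: measurable_funM => //; exact: measurableT_comp.
transitivity (lim (\int[m]_x (h n (Y x) * p x)%:E @[n --> \oo])).
  rewrite -monotone_convergence//=.
  - apply: eq_integral => x _; apply/esym/cvg_lim => //.
    under eq_fun do rewrite EFinM.
    rewrite EFinM; apply: cvgeZr => //.
    have := @cvg_nnsfun_approx _ _ _ _ measurableT (EFin \o f) mf; apply => //.
    by move=> y _; rewrite lee_fin.
  - by move=> n; apply/measurable_EFinP.
  - by move=> n x _; rewrite lee_fin mulr_ge0.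
  - move=> x _ a b ab; rewrite lee_fin ler_wpM2r//.
    exact/lefP/nd_nnsfun_approx.
apply: congr_lim; apply/funext => n.
transitivity (\int[m]_x
   (\sum_(r \in range (h n)) (r * (\1_(h n @^-1` [set r]) (Y x) * p x))%:E)).
  apply: eq_integral => x _; rewrite {1}fimfunE.
  rewrite fsumEFin//; congr EFin.
  rewrite !fsbig_finite//= mulr_suml; apply: eq_bigr => i _.
  by rewrite mulrA.
rewrite ge0_integral_fsum//=.
- apply: eq_fsbigr => r /[!inE] -[y _ <-].
  under eq_integral do rewrite EFinM.
  rewrite ge0_integralZl//.
  + apply/measurable_EFinP; apply: measurable_funM => //.
    by apply: measurableT_comp => //; exact: measurable_indic.
  + by move=> x _; rewrite lee_fin mulr_ge0// indicE.
  + by rewrite lee_fin.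
- move=> r; apply/measurable_EFinP; apply: measurable_funM => //.
  apply: measurable_funM => //.
  by apply: measurableT_comp => //; exact: measurable_indic.
- move=> r x _; rewrite lee_fin mulrA mulr_ge0//.
  by have := @nnfun_muleindic_ge0 _ _ _ (h n) r (Y x); rewrite lee_fin.
Qed.

(** This single extension principle serves for densities
    ([ge0_integral_density]) and for independence
    ([expectation_mul_of_events]). *)
Lemma weighted_integral_ext d1 d2 d' (T1 : measurableType d1)
    (T2 : measurableType d2) (T' : measurableType d')
    (m1 : {measure set T1 -> \bar R}) (m2 : {measure set T2 -> \bar R})
    (Y1 : T1 -> T') (Y2 : T2 -> T') (p1 : T1 -> R) (p2 : T2 -> R)
    (f : T' -> R) :
  measurable_fun setT Y1 -> measurable_fun setT Y2 ->
  measurable_fun setT p1 -> measurable_fun setT p2 ->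
  (forall x, 0 <= p1 x)%R -> (forall x, 0 <= p2 x)%R ->
  (forall A, measurable A ->
    \int[m1]_x (\1_A (Y1 x) * p1 x)%:E = \int[m2]_x (\1_A (Y2 x) * p2 x)%:E) ->
  measurable_fun setT f -> (forall y, 0 <= f y)%R ->
  \int[m1]_x (f (Y1 x) * p1 x)%:E = \int[m2]_x (f (Y2 x) * p2 x)%:E.
Proof.
move=> mY1 mY2 mp1 mp2 p10 p20 m12 mf f0.
have mEf : measurable_fun setT (EFin \o f) by exact/measurable_EFinP.
rewrite (weighted_integral_approx m1 mEf)// (weighted_integral_approx m2 mEf)//.
apply: congr_lim; apply/funext => n; apply: eq_fsbigr => r _.
by rewrite m12.
Qed.

End weighted_integral.

Section density.
Local Open Scope ereal_scope.
Context {R : realType}.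

Lemma ge0_integral_density (nu : {measure set (measurableTypeR R) -> \bar R})
    (p g : R -> R) :
  measurable_fun setT p -> (forall x, 0 <= p x)%R ->
  (forall A, measurable A -> nu A = \int[@lebesgue_measure R]_(x in A) (p x)%:E) ->
  measurable_fun setT g -> (forall x, 0 <= g x)%R ->
  \int[nu]_x (g x)%:E = \int[@lebesgue_measure R]_x (g x * p x)%:E.
Proof.
move=> mp p0 nup mg g0.
rewrite -(@weighted_integral_ext _ _ _ _ _ _ _ nu _ id id (cst 1%R) p g)//.

- by under [RHS]eq_integral do rewrite mulr1.
- move=> A mA; under eq_integral do rewrite mulr1.
  rewrite integral_indic// setIT nup// [LHS]integral_mkcond.
  apply: eq_integral => x _; rewrite patchE indicE.
  by case: ifPn => xA; rewrite ?mul1r ?mul0r.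
Qed.

End density.

(** * Independence and bounded test functions *)

Section real_integrable.
Context {R : realType} d {T : measurableType d} (m : {measure set T -> \bar R}).
Context (D : set T) (mD : measurable D).
Implicit Types f g : T -> R.

Lemma rintegrableZl (c : R) f : m.-integrable D (EFin \o f) ->
  m.-integrable D (EFin \o (fun x => c * f x)).
Proof.
by move=> h; have := integrableZl mD c h; apply: eq_integrable => // x _ /=.
Qed.

Lemma rintegrableZr (c : R) f : m.-integrable D (EFin \o f) ->
  m.-integrable D (EFin \o (fun x => f x * c)).
Proof.
by move=> h; have := rintegrableZl c h;
  apply: eq_integrable => // x _ /=; rewrite mulrC.
Qed.

Lemma rintegrableD f g : m.-integrable D (EFin \o f) ->
  m.-integrable D (EFin \o g) -> m.-integrable D (EFin \o (fun x => f x + g x)).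
Proof.
by move=> hf hg; have := integrableD mD hf hg; apply: eq_integrable => // x _ /=.
Qed.

Lemma rintegrableB f g : m.-integrable D (EFin \o f) ->
  m.-integrable D (EFin \o g) -> m.-integrable D (EFin \o (fun x => f x - g x)).
Proof.
by move=> hf hg; have := integrableB mD hf hg; apply: eq_integrable => // x _ /=.
Qed.

Lemma EFin_Rintegral f : m.-integrable D (EFin \o f) ->
  (\int[m]_(x in D) (f x)%:E)%E = (\int[m]_(x in D) f x)%:E.
Proof. by move=> ?; rewrite /Rintegral fineK//; exact: integrable_fin_num. Qed.

End real_integrable.

Section bounded_functions.
Context {R : realType} d {T : measurableType d} (P : probability T R).
Implicit Types f g W : T -> R.

Lemma bounded_integrable f (C : R) : measurable_fun setT f ->
  (forall x, `|f x| <= C) -> P.-integrable setT (EFin \o f).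
Proof.
move=> mf fC; apply: (@le_integrable _ _ _ P _ measurableT _ (cst C%:E)).
- exact/measurable_EFinP.
- by move=> x _ /=; rewrite lee_fin (le_trans (fC x))// ler_norm.
- exact: finite_measure_integrable_cst.
Qed.

Lemma Rintegral_cst_probability (c : R) : \int[P]_x c = c.
Proof. by rewrite Rintegral_cst//= probability_setT mulr1. Qed.

Lemma Rintegral_indic_preimage (Y : T -> R) A :
  measurable_fun setT Y -> measurable A ->
  \int[P]_x \1_A (Y x) = fine (P (Y @^-1` A)).
Proof.
move=> mY mA; rewrite /Rintegral; congr fine.
rewrite -[X in P X]setIT -integral_indic//.
by rewrite -[_ @^-1` _]setTI; exact: mY.
Qed.

(** Adding constants makes W and g nonnegative; then the weight W + C and the
    constant weight E W + C give the same integrals to all events about Y,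
    hence to all nonnegative functions of Y. *)
Lemma expectation_mul_of_events (W Y : T -> R) (g : R -> R) (C D : R) :
  measurable_fun setT W -> (forall x, `|W x| <= C) ->
  measurable_fun setT Y ->
  measurable_fun setT g -> (forall y, `|g y| <= D) ->
  (forall A, measurable A -> \int[P]_x (W x * \1_A (Y x)) =
                             \int[P]_x W x * fine (P (Y @^-1` A))) ->
  \int[P]_x (W x * g (Y x)) = \int[P]_x W x * \int[P]_x g (Y x).
Proof.
move=> mW WC mY mg gD WY.
have C0 : 0 <= C by rewrite (le_trans _ (WC point)).
have D0 : 0 <= D by rewrite (le_trans _ (gD point)).
have mgY : measurable_fun setT (g \o Y) by exact: measurableT_comp.
have iW := bounded_integrable mW WC.
have ig : P.-integrable setT (EFin \o (g \o Y)).
  by apply: (bounded_integrable mgY) => x; exact: gD.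
have iWg : P.-integrable setT (EFin \o (fun x => W x * g (Y x))).
  apply: (@bounded_integrable _ (C * D)); first exact: measurable_funM.
  by move=> x; rewrite normrM ler_pM.
have ic (c : R) : P.-integrable setT (EFin \o (fun=> c)).
  exact: finite_measure_integrable_cst.
have icst (c : R) : \int[P]_x c = c.
  exact: Rintegral_cst_probability.
have EWC : \int[P]_x (W x + C) = \int[P]_x W x + C by rewrite RintegralD// icst.
have EWC0 : 0 <= \int[P]_x W x + C.
  by rewrite -EWC; apply: Rintegral_ge0 => x _; have := WC x; rewrite ler_norml; lra.
have key : \int[P]_x ((g (Y x) + D) * (W x + C)) =
           \int[P]_x ((g (Y x) + D) * (\int[P]_x W x + C)).
  congr fine.
  apply: (@weighted_integral_ext _ _ _ _ _ _ _ P P Y Y (fun x => W x + C)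
    (fun=> \int[P]_x W x + C) (fun y => g y + D)) => //.
  - exact: measurable_funD.
  - by move=> x; have := WC x; rewrite ler_norml; lra.
  - move=> A mA.
    have m1 : measurable_fun setT (fun x => \1_A (Y x) : R).
      by apply: measurableT_comp => //; exact: measurable_indic.
    have i1 : P.-integrable setT (EFin \o (fun x => \1_A (Y x) : R)).
      apply: (@bounded_integrable _ 1) => // x.
      by rewrite indicE; case: (_ \in _); rewrite ?normr1 ?normr0.
    have i1W : P.-integrable setT (EFin \o (fun x => W x * \1_A (Y x))).
      apply: (@bounded_integrable _ C); first exact: measurable_funM.
      move=> x; rewrite indicE; case: (_ \in _); rewrite ?mulr1 ?mulr0 ?normr0//.
    have iA2 : P.-integrable setT
        (EFin \o (fun x => \1_A (Y x) * (\int[P]_x W x + C))).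
      exact: rintegrableZr.
    have iA1 : P.-integrable setT (EFin \o (fun x => \1_A (Y x) * (W x + C))).
      apply: (@bounded_integrable _ (C + C)).
        by apply: measurable_funM => //; exact: measurable_funD.
      move=> x; have /ler_normlP[? ?] := WC x.
      rewrite indicE; case: (_ \in _);
        rewrite ?mul1r ?mul0r ?normr0 ?addr_ge0// ler_norml; lra.
    rewrite !EFin_Rintegral//.
    congr EFin.
    under eq_Rintegral do rewrite mulrDr mulrC (mulrC _ C).
    rewrite RintegralD//; last exact: rintegrableZl.
    rewrite RintegralZl// WY// RintegralZr// Rintegral_indic_preimage//.
    ring.
  - exact: measurable_funD.
  - by move=> y; have := gD y; rewrite ler_norml; lra.
have igD : P.-integrable setT (EFin \o (fun x => g (Y x) + D)).
  exact: rintegrableD.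
have L : \int[P]_x ((g (Y x) + D) * (W x + C)) =
   \int[P]_x (W x * g (Y x)) + C * \int[P]_x g (Y x) + D * \int[P]_x W x + D * C.
  transitivity (\int[P]_x (W x * g (Y x) + C * g (Y x) + (D * W x + D * C))).
    by apply: eq_Rintegral => x _; ring.
  rewrite RintegralD//; first last.
  - by apply: rintegrableD => //; exact: rintegrableZl.
  - by apply: rintegrableD => //; exact: rintegrableZl.
  rewrite RintegralD//; last exact: rintegrableZl.
  rewrite RintegralD//; last exact: rintegrableZl.
  by rewrite !RintegralZl// icst addrA.
have r : \int[P]_x ((g (Y x) + D) * (\int[P]_x W x + C)) =
   (\int[P]_x g (Y x) + D) * (\int[P]_x W x + C).
  by rewrite RintegralZr// RintegralD// icst.
by move: key; rewrite L r => h; lra.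
Qed.

End bounded_functions.

Section independent_sums.
Context {R : realType} d {T : measurableType d} (P : probability T R).
Context (N : nat) (X : 'I_N -> {RV P >-> R}).
Hypothesis indepX : mutually_independent P X.

Definition tail_event (m : nat) (B : 'I_N -> set R) : set T :=
  \bigcap_(i in [set` [set i : 'I_N | (m <= i)%N]%SET]) (X i @^-1` B i).

(** The property propagated along the sum: W, a function of the first m
    variables, is uncorrelated with all events about the remaining ones. It
    only involves indicators, so mutual independence of events applies
    directly. *)
Definition independent_of_tail (m : nat) (W : T -> R) :=
  forall B, (forall i, measurable (B i)) ->
    \int[P]_x (W x * \1_(tail_event m B) x) =
    \int[P]_x W x * fine (P (tail_event m B)).

Let mX i : measurable_fun setT (X i). Proof. exact: measurable_funPT. Qed.

Lemma measurable_tail_event m B : (forall i, measurable (B i)) ->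
  measurable (tail_event m B).
Proof.
move=> mB; apply: fin_bigcap_measurable => [|i _]; first exact: finite_finset.
by rewrite -[_ @^-1` _]setTI; exact: mX.
Qed.

Lemma tail_eventS (j : 'I_N) A B :
  tail_event j (fun i => if i == j then A else B i) =
  X j @^-1` A `&` tail_event j.+1 B.
Proof.
apply/seteqP; split => x.
- move=> h; split.
  + by have := h j; rewrite /= inE leqnn eqxx; apply.
  + move=> i /=; rewrite inE => ji; have := h i; rewrite /= inE (ltnW ji).
    have -> : (i == j) = false by apply/eqP => ij; move: ji; rewrite ij ltnn.
    by apply.
- move=> [xA h] i /=; rewrite inE => ji; case: eqP => [->//|/eqP ij].
  by apply: h; rewrite /= inE ltn_neqAle ji andbT eq_sym.
Qed.

Lemma probability_tail_event m B : (forall i, measurable (B i)) ->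
  P (tail_event m B) = (\prod_(i < N | (m <= i)%N) P (X i @^-1` B i))%E.
Proof.
by move=> mB; rewrite /tail_event indepX//; apply: eq_bigl => i; rewrite inE.
Qed.

Lemma probability_tail_eventS (j : 'I_N) A B : measurable A ->
  (forall i, measurable (B i)) ->
  P (X j @^-1` A `&` tail_event j.+1 B) =
  (P (X j @^-1` A) * P (tail_event j.+1 B))%E.
Proof.
move=> mA mB; rewrite -tail_eventS !probability_tail_event//; last first.
  by move=> i; case: ifP.
rewrite (bigD1 j)//= eqxx; congr (_ * _)%E.
apply: eq_big => [i|i /andP[ji ij]]; last by rewrite (negbTE ij).
by rewrite [RHS]ltn_neqAle andbC eq_sym.
Qed.

(** Multiplying W by a function of the next variable preserves independence
    from the later ones and factors the expectation: apply
    [expectation_mul_of_events] to W times the indicator of an event about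
    the later variables. *)
Lemma expectation_mul_tail (j : 'I_N) (W : T -> R) (g : R -> R) (C D : R) :
  measurable_fun setT W -> (forall x, `|W x| <= C) ->
  measurable_fun setT g -> (forall y, `|g y| <= D) ->
  independent_of_tail j W ->
  \int[P]_x (W x * g (X j x)) = \int[P]_x W x * \int[P]_x g (X j x) /\
  independent_of_tail j.+1 (fun x => W x * g (X j x)).
Proof.
move=> mW WC mg gD tW.
have key B : (forall i, measurable (B i)) ->
    \int[P]_x (W x * \1_(tail_event j.+1 B) x * g (X j x)) =
    \int[P]_x W x * fine (P (tail_event j.+1 B)) * \int[P]_x g (X j x).
  move=> mB; have mE := measurable_tail_event j.+1 mB.
  have EW : \int[P]_x (W x * \1_(tail_event j.+1 B) x) =
      \int[P]_x W x * fine (P (tail_event j.+1 B)).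
    have := tW (fun i => if i == j then setT else B i).
    by rewrite tail_eventS preimage_setT setTI; apply => i; case: ifP.
  rewrite (@expectation_mul_of_events _ _ _ _ _ _ _ C D)//.
  - by rewrite EW.
  - apply: measurable_funM => //; exact: measurable_indic.
  - by move=> x; rewrite indicE; case: (_ \in _);
      rewrite ?mulr1 ?mulr0 ?normr0// (le_trans _ (WC x)).
  - move=> A mA; rewrite EW.
    have := tW (fun i => if i == j then A else B i).
    rewrite tail_eventS probability_tail_eventS// => h.
    rewrite -mulrA (mulrC (fine (P (tail_event _ _)))).
    have <- : fine (P (X j @^-1` A) * P (tail_event j.+1 B))%E =
       fine (P (X j @^-1` A)) * fine (P (tail_event j.+1 B)).
      have mXA : measurable (X j @^-1` A) by rewrite -[_ @^-1` _]setTI; exact: mX.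
      by rewrite fineM// fin_num_measure.
    rewrite -h => [|i]; last by case: ifP.
    apply: eq_Rintegral => x _; rewrite -mulrA; congr (_ * _).
    by rewrite indicI/= mulrC.
have E1 : \int[P]_x (W x * g (X j x)) = \int[P]_x W x * \int[P]_x g (X j x).
  have := key (fun=> setT) (fun=> measurableT).
  have -> : tail_event j.+1 (fun=> setT) = setT.
    by apply/seteqP; split.
  rewrite probability_setT mulr1 => <-; apply: eq_Rintegral => x _.
  by rewrite indicT mulr1.
split=> // B mB; rewrite E1 -[RHS]mulrAC -key//.
by apply: eq_Rintegral => x _; rewrite mulrAC.
Qed.

Lemma independent_of_tail1 : independent_of_tail 0 (fun=> 1).
Proof.
move=> B mB; rewrite Rintegral_cst_probability mul1r.
under eq_Rintegral do rewrite mul1r.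
by rewrite /Rintegral integral_indic ?setIT//; exact: measurable_tail_event.
Qed.

(** Needed because the addition formula writes cos (th + t (S + X)) as a sum
    of two products. *)
Lemma independent_of_tailZD m (a b C D : R) (U V : T -> R) :
  measurable_fun setT U -> (forall x, `|U x| <= C) ->
  measurable_fun setT V -> (forall x, `|V x| <= D) ->
  independent_of_tail m U -> independent_of_tail m V ->
  independent_of_tail m (fun x => a * U x + b * V x).
Proof.
move=> mU UC mV VD tU tV B mB.
have iU := bounded_integrable P mU UC.
have iV := bounded_integrable P mV VD.
have mE := measurable_tail_event m mB.
have iE (W : T -> R) c : measurable_fun setT W -> (forall x, `|W x| <= c) ->
    P.-integrable setT (EFin \o (fun x => W x * \1_(tail_event m B) x)).
  move=> mW Wc; apply: (@bounded_integrable _ _ _ _ _ c).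
    by apply: measurable_funM => //; exact: measurable_indic.
  by move=> x; rewrite indicE; case: (_ \in _);
      rewrite ?mulr1 ?mulr0 ?normr0// (le_trans _ (Wc x)).
rewrite RintegralD//; [|exact: rintegrableZl|exact: rintegrableZl].
rewrite !RintegralZl//.
transitivity (\int[P]_x (a * (U x * \1_(tail_event m B) x) +
                         b * (V x * \1_(tail_event m B) x))).
  by apply: eq_Rintegral => x _; ring.
have iUE := iE _ _ mU UC; have iVE := iE _ _ mV VD.
rewrite RintegralD//; [|exact: rintegrableZl|exact: rintegrableZl].
by rewrite !RintegralZl// tU// tV//; ring.
Qed.

End independent_sums.

(** * Phase characteristic functions *)

Section polar.
Context {R : realType}.

Lemma polar_form (c s : R) :
  exists rho phi : R, [/\ 0 <= rho, c = rho * cos phi & s = rho * sin phi].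
Proof.
pose rho := Num.sqrt (c ^+ 2 + s ^+ 2).
have rho0 : 0 <= rho by exact: sqrtr_ge0.
have rho2 : rho ^+ 2 = c ^+ 2 + s ^+ 2 by rewrite sqr_sqrtr// addr_ge0 ?sqr_ge0.
have [r0|r0] := eqVneq rho 0.
  exists 0, 0; rewrite !mul0r; move: rho2; rewrite r0 expr0n/= => /esym/eqP.
  by rewrite paddr_eq0 ?sqr_ge0// !sqrf_eq0 => /andP[/eqP -> /eqP ->].
have rp : 0 < rho by rewrite lt_neqAle eq_sym r0.
have xB : -1 <= c / rho <= 1.
  rewrite -ler_norml normrM (ger0_norm (_ : 0 <= rho^-1)) ?invr_ge0//.
  rewrite ler_pdivrMr// mul1r -ler_sqr ?nnegrE// real_normK ?num_real// rho2.
  by rewrite lerDl sqr_ge0.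
have sE : 1 - (c / rho) ^+ 2 = (s / rho) ^+ 2.
  apply/eqP; rewrite subr_eq !exprMn -mulrDl addrC -rho2 exprVn divff//.
  by rewrite sqrf_eq0.
have [s0|s0] := leP 0 s.
  exists rho, (acos (c / rho)); split=> //.
    by rewrite acosK ?in_itv//= mulrC divfK.
  by rewrite sin_acos// sE sqrtr_sqr ger0_norm ?divr_ge0// mulrC divfK.
exists rho, (- acos (c / rho)); split=> //.
  by rewrite cosN acosK ?in_itv//= mulrC divfK.
rewrite sinN sin_acos// sE sqrtr_sqr ltr0_norm ?opprK.
  by rewrite mulrC divfK.
by rewrite pmulr_llt0// invr_gt0.
Qed.

(** The telescoping bound for the difference of two N-th powers, in polar
    form: the factor rho cos (_ + phi) is exchanged for r cos one at a time. *)
Lemma polar_power_diff (rho phi r q e : R) N :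
  0 <= rho -> 0 <= r -> rho <= q -> r <= q ->
  (forall th, `|rho * cos (th + phi) - r * cos th| <= e) ->
  forall th, `|rho ^+ N * cos (th + N%:R * phi) - r ^+ N * cos th|
    <= N%:R * e * q ^+ N.-1.
Proof.
move=> rho0 r0 rhoq rq he th.
have q0 : 0 <= q := le_trans r0 rq.
have e0 : 0 <= e := le_trans (normr_ge0 _) (he 0).
elim: N => [|N IH]; first by rewrite !expr0 !mul0r addr0 subrr normr0.
have -> : rho ^+ N.+1 * cos (th + N.+1%:R * phi) - r ^+ N.+1 * cos th =
  rho ^+ N * (rho * cos (th + N%:R * phi + phi) - r * cos (th + N%:R * phi)) +
  r * (rho ^+ N * cos (th + N%:R * phi) - r ^+ N * cos th).
  by rewrite -natr1 mulrDl mul1r addrA !exprS; ring.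
rewrite (le_trans (ler_normD _ _))// !normrM.
rewrite (ger0_norm r0) (ger0_norm (exprn_ge0 N rho0)).
have h1 : rho ^+ N * `|rho * cos (th + N%:R * phi + phi) - r * cos (th + N%:R * phi)|
    <= q ^+ N * e.
  by apply: ler_pM => //; [exact: exprn_ge0|exact: lerXn2r].
have h2 : r * `|rho ^+ N * cos (th + N%:R * phi) - r ^+ N * cos th|
   <= N%:R * e * q ^+ N.
  rewrite (le_trans (ler_pM _ _ rq IH))//.
  case: N {IH h1} => [|N]; first by rewrite !mul0r mulr0.
  by rewrite mulrCA -exprS.
by rewrite (le_trans (lerD h1 h2))// -natr1 /=; lra.
Qed.

End polar.

Section phase_cf.
Context {R : realType}.

(** The real part of exp (i th) times the characteristic function of Y at t;
    knowing it for all th amounts to knowing the complex value, and its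
    maximum over th is the modulus. *)
Definition phase_cf d (T : measurableType d) (P : probability T R) (Y : T -> R)
  (th t : R) : R := \int[P]_x cos (th + t * Y x).

Lemma measurable_cos : measurable_fun setT (@cos R).
Proof. by apply: continuous_measurable_fun; exact: continuous_cos. Qed.

Lemma measurable_sin : measurable_fun setT (@sin R).
Proof. by apply: continuous_measurable_fun; exact: continuous_sin. Qed.

Section one_variable.
Context d (T : measurableType d) (P : probability T R).
Context (Y : T -> R) (mY : measurable_fun setT Y).

Lemma measurable_phase th t : measurable_fun setT (fun x => cos (th + t * Y x)).
Proof.
apply: (measurableT_comp measurable_cos); apply: measurable_funD => //.
exact: measurable_funM.
Qed.

Lemma integrable_phase th t :
  P.-integrable setT (EFin \o (fun x => cos (th + t * Y x))).
Proof.
apply: (@bounded_integrable _ _ _ _ _ 1); first exact: measurable_phase.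
by move=> x; exact: cos_max.
Qed.

Lemma phase_cfE th t : phase_cf P Y th t =
  cos th * phase_cf P Y 0 t + sin th * phase_cf P Y (pi / 2) t.
Proof.
rewrite /phase_cf -!RintegralZl//; [|exact: integrable_phase..].
rewrite -RintegralD//; [|exact/rintegrableZl/integrable_phase..].
apply: eq_Rintegral => x _; rewrite add0r (addrC (pi / 2)) cosDpihalf cosD; ring.
Qed.

Lemma phase_cf_polar t : exists rho phi : R, 0 <= rho /\
  forall th, phase_cf P Y th t = rho * cos (th + phi).
Proof.
have [rho [phi [rho0 c s]]] :=
  polar_form (phase_cf P Y 0 t) (- phase_cf P Y (pi / 2) t).
exists rho, phi; split=> // th; rewrite phase_cfE c cosD.
have -> : phase_cf P Y (pi / 2) t = - (rho * sin phi) by rewrite -s opprK.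
ring.
Qed.

End one_variable.

(** Multiplicativity of characteristic functions. The induction carries along
    that cos (th + t S) is independent of the variables still to be added. *)
Lemma phase_cf_sum d (T : measurableType d) (P : probability T R) (N : nat)
    (X : 'I_N -> {RV P >-> R}) (t rho phi : R) :
  mutually_independent P X ->
  (forall i th, phase_cf P (X i) th t = rho * cos (th + phi)) ->
  forall th, phase_cf P (fun x => \sum_(i < N) X i x) th t =
    rho ^+ N * cos (th + N%:R * phi).
Proof.
move=> indepX Xcf.
have mX i : measurable_fun setT (X i) by exact: measurable_funPT.
pose S m x := \sum_(i < N | (i < m)%N) X i x.
have mS m : measurable_fun setT (S m).
  rewrite /S; under eq_fun do rewrite big_mkcond/=.
  by apply: measurable_sum => i; case: (_ < _)%N.
suff h m : (m <= N)%N -> (forall th, phase_cf P (S m) th t =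
      rho ^+ m * cos (th + m%:R * phi)) /\
    (forall th, independent_of_tail X m (fun x => cos (th + t * S m x))).
  move=> th; have [<- _] := h N (leqnn N).
  by apply: eq_Rintegral => x _; congr (cos (_ + _ * _)); rewrite /S;
    apply: eq_bigl => i; rewrite ltn_ord.
elim: m => [_|m IH mN].
  have S0 x : S 0%N x = 0 by rewrite /S big_pred0.
  split=> th.
    rewrite expr0 mul1r mul0r addr0 /phase_cf.
    under eq_Rintegral do rewrite S0 mulr0 addr0.
    exact: Rintegral_cst_probability.
  have -> : (fun x => cos (th + t * S 0%N x)) =
      (fun x => cos th * (fun=> 1) x + 0 * (fun=> 1) x).
    by apply/funext => x; rewrite S0 mulr0 addr0 mul0r mulr1 addr0.
  apply: (@independent_of_tailZD _ _ _ _ _ _ _ _ _ 1 1) => //;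
    try (by move=> x; rewrite normr1); exact: independent_of_tail1.
have [E I] := IH (ltnW mN).
pose j := Ordinal mN.
have SS x : S m.+1 x = S m x + X j x.
  rewrite /S (bigD1 j)//= addrC; congr (_ + _).
  apply: eq_bigl => i; rewrite ltnS ltn_neqAle andbC.
  by congr (_ && _); rewrite -val_eqE.
have cosSS th : (fun x => cos (th + t * S m.+1 x)) = (fun x =>
    1 * (cos (th + t * S m x) * cos (0 + t * X j x)) +
    1 * (cos (th + pi / 2 + t * S m x) * cos (- (pi / 2) + t * X j x))).
  apply/funext => x; rewrite SS mulrDr addrA cosD add0r !mul1r.
  rewrite (addrAC th) cosDpihalf (addrC _ (t * X j x)) cosBpihalf.
  by rewrite mulNr.
have mc c : measurable_fun setT (fun y : R => cos (c + t * y)).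
  by apply: (@measurable_phase _ _ id).
have step th c := @expectation_mul_tail _ _ _ P _ X indepX j
  (fun x => cos (th + t * S m x)) (fun y => cos (c + t * y)) 1 1
  (measurable_phase (mS m) th t) (fun=> cos_max _) (mc c) (fun=> cos_max _) (I th).
have mp th c : measurable_fun setT
    (fun x => cos (th + t * S m x) * cos (c + t * X j x)).
  by apply: measurable_funM; exact: measurable_phase.
have bp th c x : `|cos (th + t * S m x) * cos (c + t * X j x)| <= 1.
  by rewrite normrM mulr_ile1// cos_max.
split=> th.
  rewrite /phase_cf cosSS.
  rewrite RintegralD//;
     [|apply: rintegrableZl => //; exact: (bounded_integrable P (mp _ _) (bp _ _))..].
  under eq_Rintegral do rewrite mul1r.
  under [X in _ + X]eq_Rintegral do rewrite mul1r.
  rewrite (step th 0).1 (step _ _).1.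
  have F := Xcf j; rewrite /phase_cf in F E; rewrite !F !E.
  rewrite add0r (addrAC th) cosDpihalf (addrC (- _)) cosBpihalf.
  by rewrite -natr1 mulrDl mul1r addrA (cosD (th + _)) exprSr; ring.
rewrite cosSS.
by apply: (@independent_of_tailZD _ _ _ _ _ _ _ _ _ 1 1) => //;
  [exact: (step _ _).2|exact: (step _ _).2].
Qed.

End phase_cf.

(** * Improper integrals of derivatives *)

Section improper_integrals.
Context {R : realType}.
Notation leb := (@lebesgue_measure R).

Lemma is_derive_continuous (f f' : R -> R) :
  (forall x : R, is_derive x 1 f (f' x)) -> continuous f.
Proof.
move=> df x; apply/differentiable_continuous/derivable1_diffP.
by have [] := df x.
Qed.

Lemma Rintegral_derive (F f : R -> R) (a b : R) : a <= b ->
  (forall x : R, is_derive x 1 F (f x)) -> continuous f ->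
  \int[leb]_(x in `[a, b]) f x = F b - F a.
Proof.
rewrite le_eqVlt => /predU1P[<- _ _|ab dF cf].
  by rewrite set_itv1 Rintegral_set1 subrr.
have cF := is_derive_continuous dF.
rewrite /Rintegral (@continuous_FTC2 _ f F)//.
- exact: continuous_subspaceT.
- split.
  + by move=> x _; have [] := dF x.
  + by apply: cvg_at_right_filter; exact: cF.
  + by apply: cvg_at_left_filter; exact: cF.
- by move=> x _; rewrite derive1E; have [] := dF x.
Qed.

(** Dominated convergence over the exhausting intervals; F need only have a
    limit along them, so oscillating integrands are allowed. *)
Lemma improper_Rintegral_derive (D : set R) (a b : nat -> R) (F f : R -> R) (l : R) :
  measurable D -> (forall x : R, is_derive x 1 F (f x)) -> continuous f ->
  leb.-integrable D (EFin \o f) ->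
  (forall n, a n <= b n) -> (forall n, `[a n, b n] `<=` D) ->
  (forall x, D x -> \forall n \near \oo, a n <= x <= b n) ->
  F (b n) - F (a n) @[n --> \oo] --> l ->
  \int[leb]_(x in D) f x = l.
Proof.
move=> mD dF cf iF ab abD Dab Fl.
have mf : measurable_fun setT f by exact: continuous_measurable_fun.
pose f_ n x := (f \_ `[a n, b n]) x.
have mf_ n : measurable_fun D (EFin \o f_ n).
  apply/measurable_EFinP/measurable_funTS.
  apply/(@measurable_restrict _ _ _ _ `[a n, b n] setT) => //.
  exact: measurable_funTS.
have f_cvg x : D x -> EFin (f_ n x) @[n --> \oo] --> (f x)%:E.
  move=> Dx; apply: cvg_near_cst; near=> n; rewrite /f_ patchE mem_set//=.
  by rewrite in_itv/=; near: n; exact: Dab.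
have f_le n x : D x -> (`|(f_ n x)%:E| <= `|f x|%:E)%E.
  by move=> _; rewrite /= lee_fin /f_ patchE; case: ifPn => // _; rewrite normr0.
have [||||_ _ cvI] := @dominated_convergence _ _ _ leb _ mD
  (fun n => EFin \o f_ n) (EFin \o f) (EFin \o (fun x => `|f x|)) mf_.
- exact: measurable_int iF.
- by apply: aeW => x Dx; exact: f_cvg.
- exact: integrable_norm.
- by apply: aeW => x n Dx; exact: f_le.
have ffE n : \int[leb]_(x in D) f_ n x = F (b n) - F (a n).
  rewrite -(Rintegral_derive (ab n) dF cf) -[in RHS](setIidr (abD n)).
  by rewrite Rintegral_mkcondr.
have {}cvI : \int[leb]_(x in D) f_ n x @[n --> \oo] --> \int[leb]_(x in D) f x.
  apply: fine_cvg; rewrite /Rintegral fineK//; exact: integrable_fin_num.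
apply/(cvg_unique _ _ Fl); first exact: norm_hausdorff.
apply: cvg_trans cvI; apply: near_eq_cvg; apply: nearW => n /=.
by rewrite ffE.
Unshelve. all: by end_near. Qed.

Lemma cvg_expR_decay (c : R) : 0 < c -> expR (- (c * n%:R)) @[n --> \oo] --> (0 : R).
Proof.
move=> c0; apply: (cvg_comp (fun n : nat => c * n%:R) (fun x => expR (- x)) _ (@cvgr_expR R)).
apply/cvgryPge => M; near=> n.
by rewrite mulrC -ler_pdivrMr//; near: n; exact: nbhs_infty_ger.
Unshelve. all: by end_near. Qed.

End improper_integrals.

(** * The standard Gaussian law *)

Section gaussian.
Context {R : realType}.
Notation leb := (@lebesgue_measure R).
Notation gauss := (@normal_prob R 0 1).

Definition gauss_density (u : R) : R := expR (- (u ^+ 2 / 2)) / Num.sqrt (2 * pi).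

Lemma normal_pdf01 : normal_pdf 0 1 = gauss_density.
Proof.
apply/funext => u; rewrite normal_pdfE ?oner_neq0// /normal_peak /normal_fun.
rewrite subr0 expr1n mul1r mulrC /gauss_density mulNr mulr_natl.
by [].
Qed.

Lemma gauss_density_ge0 u : 0 <= gauss_density u.
Proof. by rewrite -normal_pdf01 normal_pdf_ge0. Qed.

Lemma continuous_gauss_density : continuous gauss_density.
Proof. by rewrite -normal_pdf01; apply: continuous_normal_pdf; exact: oner_neq0. Qed.

Lemma measurable_gauss_density : measurable_fun setT gauss_density.
Proof. exact: continuous_measurable_fun continuous_gauss_density. Qed.

Lemma sqrt2pi_ge2 : 2 <= Num.sqrt (2 * pi : R).
Proof.
rewrite -(ler_sqr) ?nnegrE ?sqrtr_ge0//.
by rewrite sqr_sqrtr ?mulr_ge0 ?pi_ge0//; have := @pi_ge2 R; lra.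
Qed.

Lemma gauss_density_le_half u : gauss_density u <= 1 / 2.
Proof.
rewrite /gauss_density; apply: ler_pM; rewrite ?expR_ge0 ?invr_ge0 ?sqrtr_ge0//.
- by rewrite expR_le1 oppr_le0 divr_ge0 ?sqr_ge0.
- by rewrite lef_pV2 ?posrE ?sqrt2pi_ge2// (lt_le_trans _ sqrt2pi_ge2).
Qed.

(** The density is at most 1 / sqrt (2 pi), rounded up to 1/2. *)
Lemma gauss_interval_le (a b : R) : a <= b ->
  (gauss `]a, b] <= (1 / 2 * (b - a))%:E)%E.
Proof.
move=> ab; rewrite /normal_prob normal_pdf01.
apply: (@le_trans _ _ (\int[leb]_(x in `]a, b]) (1 / 2)%:E)%E).
  apply: ge0_le_integral => //.
  - by move=> x _; rewrite lee_fin gauss_density_ge0.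
  - by apply/measurable_EFinP/measurable_funTS; exact: measurable_gauss_density.
  - by move=> x _; rewrite lee_fin gauss_density_le_half.
rewrite integral_cst//= lebesgue_measure_itv/= lte_fin.
case: ifP => _; first by rewrite -EFinD -EFinM.
by rewrite mule0 lee_fin mulr_ge0// subr_ge0.
Qed.

(** The growth allowed for test functions: the density times exp (u^2 / 4) is
    still integrable, and every polynomial is dominated by a multiple of it. *)
Definition quarter (u : R) : R := expR (u ^+ 2 / 4).

Lemma continuous_quarter : continuous quarter.
Proof.
apply: (@is_derive_continuous _ _ (fun u => quarter u * (u / 2))) => u.
rewrite /quarter; derive_eq.
by rewrite /=; field.
Qed.

Lemma quarter_ge1 u : 1 <= quarter u.
Proof. by rewrite -expR0 ler_expR divr_ge0 ?sqr_ge0. Qed.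

Lemma quarter_gauss_density u :
  quarter u * gauss_density u = expR (- (u ^+ 2 / 4)) / Num.sqrt (2 * pi).
Proof. by rewrite /quarter /gauss_density mulrA -expRD; congr (expR _ / _); field. Qed.

Lemma quarter_gauss_density_le u :
  quarter u * gauss_density u <= expR (- (u ^+ 2 / 4)).
Proof.
rewrite quarter_gauss_density ler_piMr ?expR_ge0// invf_le1 ?(le_trans _ sqrt2pi_ge2)//.
  by lra.
by rewrite (lt_le_trans _ sqrt2pi_ge2).
Qed.

(** Up to a constant this is the normal density of variance 2. *)
Lemma integrable_quarter_gauss_density :
  leb.-integrable setT (EFin \o (fun u => quarter u * gauss_density u)).
Proof.
have s0 : Num.sqrt 2 != 0 :> R by rewrite gt_eqF// sqrtr_gt0.
have := integrable_normal_pdf (0 : R) (Num.sqrt 2).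
move=> /(@rintegrableZl _ _ _ _ _ measurableT
  ((normal_peak (Num.sqrt 2))^-1 / Num.sqrt (2 * pi))).
apply: eq_integrable => // u _ /=; congr EFin.
rewrite normal_pdfE// quarter_gauss_density /normal_fun subr0 sqr_sqrtr//.
rewrite mulrACA mulVf ?gt_eqF ?normal_peak_gt0// mul1r mulrC mulNr; congr (expR (- (_ / _)) / _).
by rewrite -mulr_natr; lra.
Qed.

Section gauss_integral_of_dominated.
Variables (g : R -> R) (A : R).
Hypothesis mg : measurable_fun setT g.
Hypothesis gA : forall u, `|g u| <= A * quarter u.

Let A0 : 0 <= A.
Proof.
by have := le_trans (normr_ge0 _) (gA 0);
  rewrite /quarter expr0n mul0r expR0 mulr1.
Qed.

Let mq : measurable_fun setT quarter.
Proof. exact: continuous_measurable_fun continuous_quarter. Qed.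

Lemma integrable_mul_gauss_density :
  leb.-integrable setT (EFin \o (fun u => g u * gauss_density u)).
Proof.
have iA := rintegrableZl measurableT A integrable_quarter_gauss_density.
apply: le_integrable iA => //.
  by apply/measurable_EFinP; apply: measurable_funM => //; exact: measurable_gauss_density.
move=> u _ /=; rewrite lee_fin normrM (ger0_norm (gauss_density_ge0 u)).
apply: le_trans (ler_wpM2r (gauss_density_ge0 u) (gA u)) _.
by rewrite -mulrA ler_norm.
Qed.

Let ge0_gauss (f : R -> R) : measurable_fun setT f -> (forall x, 0 <= f x) ->
  (\int[gauss]_x (f x)%:E = \int[leb]_x (f x * gauss_density x)%:E)%E.
Proof.
move=> mf f0; apply: ge0_integral_density => //.
- exact: measurable_gauss_density.
- exact: gauss_density_ge0.
- by move=> B mB; rewrite /= /normal_prob normal_pdf01.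
Qed.

Lemma integrable_gauss : gauss.-integrable setT (EFin \o g).
Proof.
apply/integrableP; split; first exact/measurable_EFinP.
have := ge0_gauss (measurableT_comp (@normr_measurable R setT) mg) (fun=> normr_ge0 _).
rewrite /= => ->.
have /integrableP[_] := integrable_mul_gauss_density.
by under eq_integral do rewrite /= normrM (ger0_norm (gauss_density_ge0 _)).
Qed.

End gauss_integral_of_dominated.

Lemma Rintegral_gauss (g : R -> R) (A : R) : measurable_fun setT g ->
  (forall u, `|g u| <= A * quarter u) ->
  \int[gauss]_u g u = \int[leb]_u (g u * gauss_density u).
Proof.
move=> mg gA.
have A0 : 0 <= A.
  by have := le_trans (normr_ge0 _) (gA 0);
    rewrite /quarter expr0n mul0r expR0 mulr1.
have mq : measurable_fun setT quarter by exact: continuous_measurable_fun continuous_quarter.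
have mAq : measurable_fun setT (fun u => A * quarter u) by exact: measurable_funM.
have gq u : 0 <= g u + A * quarter u.
  by have /ler_normlP[] := gA u; lra.
have Aq u : 0 <= A * quarter u by rewrite mulr_ge0// expR_ge0.
have Aq' u : `|A * quarter u| <= A * quarter u by rewrite ger0_norm.
have ge0_gauss (f : R -> R) : measurable_fun setT f -> (forall x, 0 <= f x) ->
  \int[gauss]_x f x = \int[leb]_x (f x * gauss_density x).
  move=> mf f0; congr fine; apply: ge0_integral_density => //.
  - exact: measurable_gauss_density.
  - exact: gauss_density_ge0.
  - by move=> B mB; rewrite /= /normal_prob normal_pdf01.
have i1 := integrable_gauss mg gA; have i2 := integrable_gauss mAq Aq'.
have j1 := integrable_mul_gauss_density mg gA.
have j2 := integrable_mul_gauss_density mAq Aq'.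
have := ge0_gauss (fun u => g u + A * quarter u) (measurable_funD mg mAq) gq.
under [in RHS]eq_Rintegral do rewrite mulrDl.
rewrite !RintegralD// (ge0_gauss (fun u => A * quarter u))//.
exact: addIr.
Qed.

(** Integration by parts: f' - u f times the density is the derivative of f
    times the density, which vanishes at infinity. It yields the moments (f a
    monomial) and the characteristic function (f a sine). *)
Lemma gauss_stein (f f' : R -> R) (A : R) :
  (forall u : R, is_derive u 1 f (f' u)) -> continuous f' ->
  (forall u, `|f u| <= A * quarter u) ->
  (forall u, `|f' u| <= A * quarter u) ->
  (forall u, `|u * f u| <= A * quarter u) ->
  \int[gauss]_u f' u = \int[gauss]_u (u * f u).
Proof.
move=> df cf' fA f'A ufA.
have cf := is_derive_continuous df.
have cuf : continuous (fun u : R => u * f u) by move=> u; apply: cvgM; [exact: cvg_id|exact: cf].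
have mf' : measurable_fun setT f' by exact: continuous_measurable_fun.
have muf : measurable_fun setT (fun u : R => u * f u) by exact: continuous_measurable_fun.
have i1 := integrable_mul_gauss_density mf' f'A.
have i2 := integrable_mul_gauss_density muf ufA.
rewrite (Rintegral_gauss mf' f'A) (Rintegral_gauss muf ufA).
apply/eqP; rewrite -subr_eq0 -RintegralB//; apply/eqP.
have A0 : 0 <= A.
  by have := le_trans (normr_ge0 _) (fA 0);
    rewrite /quarter expr0n mul0r expR0 mulr1.
have Fdecay u : `|f u * gauss_density u| <= A * expR (- (u ^+ 2 / 4)).
  rewrite normrM (ger0_norm (gauss_density_ge0 u)).
  apply: le_trans (ler_wpM2r (gauss_density_ge0 u) (fA u)) _.
  by rewrite -mulrA ler_wpM2l// quarter_gauss_density_le.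
apply: (@improper_Rintegral_derive _ setT (fun n => - n%:R) (fun n => n%:R)
   (fun u => f u * gauss_density u)) => //.
- move=> u; have dfu := df u; rewrite /gauss_density.
  derive_eq.
  rewrite /= mulr0 add0r; field.
  by rewrite gt_eqF// (lt_le_trans _ sqrt2pi_ge2).
- move=> u; apply: cvgB; apply: cvgM; [exact: cf'| |exact: cuf|];
    exact: continuous_gauss_density.
- exact: rintegrableB.
- by move=> n; rewrite (@le_trans _ _ 0)// oppr_le0.
- move=> x _; near=> n; rewrite -ler_norml.
  by near: n; exact: nbhs_infty_ger.
- have c4 : (0 : R) < 1 / 4 by lra.
  apply: (@squeeze_cvgr _ _ _ _ (fun n => - (2 * A) * expR (- (1 / 4 * n%:R)))
      (fun n => 2 * A * expR (- (1 / 4 * n%:R)))).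
  + apply: nearW => n; rewrite mulNr -ler_norml.
    have E : expR (- (n%:R ^+ 2 / 4)) <= expR (- (1 / 4 * n%:R)) :> R.
      have : (n%:R : R) <= n%:R ^+ 2.
        rewrite -natrX ler_nat; case: n => // n.
        by rewrite expnS leq_pmulr// expn_gt0.
      by rewrite ler_expR lerN2; lra.
    have h1 := Fdecay n%:R; have h2 := Fdecay (- n%:R).
    rewrite sqrrN in h2.
    rewrite (le_trans (ler_normB _ _))// (le_trans (lerD h1 h2))//.
    by have := ler_wpM2l A0 E; lra.
  + rewrite -[X in _ --> X](mulr0 (- (2 * A))).
    by apply: cvgM; [exact: cvg_cst|exact: cvg_expR_decay].
  + rewrite -[X in _ --> X](mulr0 (2 * A)).
    by apply: cvgM; [exact: cvg_cst|exact: cvg_expR_decay].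
Unshelve. all: by end_near. Qed.

End gaussian.

Section derivative_under_integral.
Context {R : realType} d {Y : measurableType d} (m : {measure set Y -> \bar R}).

Lemma is_derive_Rintegral (B : set Y) (f f' : R -> Y -> R) (G : Y -> R) :
  measurable B -> (forall x, m.-integrable B (EFin \o f x)) ->
  (forall x y, B y -> is_derive x (1 : R) (f ^~ y) (f' x y)) ->
  (forall y, 0 <= G y) -> m.-integrable B (EFin \o G) ->
  (forall x y, B y -> `|f' x y| <= G y) ->
  forall a, is_derive a (1 : R) (fun x => \int[m]_(y in B) f x y)
    (\int[m]_(y in B) f' a y).
Proof.
move=> mB intf df G0 intG f'G a.
have Ia : `](a - 1), (a + 1)[%classic a by rewrite /= in_itv/=; lra.
have dE x y : B y -> partial1of2 f x y = f' x y.
  by move=> By; rewrite partial1of2E; have [] := df x y By.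
have derf x y : `](a - 1), (a + 1)[%classic x -> B y -> derivable (f ^~ y) x 1.
  by move=> _ By; have [] := df x y By.
have ub x y : `](a - 1), (a + 1)[%classic x -> B y -> `|partial1of2 f x y| <= G y.
  by move=> _ By; rewrite dE// f'G.
have D := @derivable_under_integral _ _ _ m f B mB a (a - 1) (a + 1) Ia
  (fun x _ => intf x) derf G G0 intG ub.
have E := @differentiation_under_integral _ _ _ m f B mB a (a - 1) (a + 1) Ia
  (fun x _ => intf x) derf G G0 intG ub.
apply: DeriveDef => //; rewrite -derive1E E.
by apply: eq_Rintegral => y /[!inE] By; rewrite dE.
Qed.

End derivative_under_integral.

Section gaussian_moments.
Context {R : realType}.
Notation gauss := (@normal_prob R 0 1).

Lemma pow_le_fact_expR (x : R) n : 0 <= x -> x ^+ n <= n`!%:R * expR x.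
Proof.
move=> x0; case: n => [|n]; first by rewrite fact0 mul1r expr0 -expR0 ler_expR.
have h := expR_ge1Dxn n x0.
have f0 : 0 < n.+1`!%:R :> R by rewrite ltr0n fact_gt0.
rewrite mulrC -ler_pdivrMr//; lra.
Qed.

Lemma pow_le_quarter j : exists A : R, forall u : R, `|u| ^+ j <= A * quarter u.
Proof.
exists (1 + 4 ^+ j * j`!%:R) => u.
have h1 : `|u| ^+ j <= 1 + (u ^+ 2) ^+ j.
  rewrite -(real_normK (num_real u)) -exprM mulnC exprM.
  by have := sqr_ge0 (`|u| ^+ j - 1); have := sqr_ge0 (`|u| ^+ j); lra.
have h2 : (u ^+ 2) ^+ j <= 4 ^+ j * j`!%:R * quarter u.
  have -> : u ^+ 2 = 4 * (u ^+ 2 / 4) by field.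
  rewrite exprMn -mulrA ler_wpM2l ?exprn_ge0//.

  by apply: pow_le_fact_expR; rewrite divr_ge0 ?sqr_ge0.
have := quarter_ge1 u; move: h1 h2; move: (_ * _%:R) => K; lra.
Qed.

Lemma measurable_exp j : measurable_fun setT (fun u : R => u ^+ j).
Proof. exact: measurable_funX. Qed.

Lemma continuous_exp j : continuous (fun u : R => u ^+ j).
Proof. exact: exprn_continuous. Qed.

Lemma integrable_gauss_norm_pow j :
  gauss.-integrable setT (EFin \o (fun u => `|u| ^+ j)).
Proof.
have [A hA] := pow_le_quarter j.
apply: (@integrable_gauss _ _ A); last by move=> u; rewrite normrX normr_id.
by apply: measurable_funX; exact: normr_measurable.
Qed.

Lemma integrable_gauss_pow j :
  gauss.-integrable setT (EFin \o (fun u => u ^+ j)).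
Proof.
have [A hA] := pow_le_quarter j.
by apply: (@integrable_gauss _ _ A) => [|u]; [exact: measurable_exp|rewrite normrX].
Qed.

Lemma gauss_moment_rec j :
  \int[gauss]_u u ^+ j.+2 = j.+1%:R * \int[gauss]_u u ^+ j.
Proof.
have [A0 h0] := pow_le_quarter j.
have [A1 h1] := pow_le_quarter j.+1.
have [A2 h2] := pow_le_quarter j.+2.
pose A := `|A1| + j.+1%:R * `|A0| + `|A2|.
have q0 u : 0 <= quarter u :> R := expR_ge0 _.
have leA (B : R) u : `|B| <= A -> B * quarter u <= A * quarter u.
  by move=> BA; rewrite ler_wpM2r// (le_trans (ler_norm _)).
rewrite -RintegralZl//; last exact: integrable_gauss_pow.
rewrite (_ : (fun u => _ ^+ j.+2) = fun u : R => u * u ^+ j.+1); last first.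
  by apply/funext => u; rewrite exprS.
apply/esym/(@gauss_stein _ _ _ A).
- by move=> u; derive_eq; rewrite /= mulr1.
- by move=> u; apply: cvgM; [exact: cvg_cst|exact: continuous_exp].
- move=> u; rewrite normrX (le_trans (h1 u))// leA// /A.
  by rewrite -addrA lerDl addr_ge0// mulr_ge0.
- move=> u; rewrite normrM normrX ger0_norm//.
  apply: le_trans (ler_wpM2l (ler0n _ _) (h0 u)) _; rewrite mulrA leA// /A.
  by rewrite normrM ger0_norm// -addrA addrCA lerDl addr_ge0.
- move=> u; rewrite -exprS normrX (le_trans (h2 u))// leA// /A lerDr.
  by rewrite addr_ge0// mulr_ge0.
Qed.

Lemma gauss_moment1 : \int[gauss]_u u = 0.
Proof.
have [A1 h1] := pow_le_quarter 1.
have q1 := @quarter_ge1 R.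
pose A := 1 + `|A1|.
have hA u : 1 <= A * quarter u.
  by have := q1 u; have := normr_ge0 A1; rewrite /A; nra.
rewrite -[RHS](Rintegral_cst_probability gauss).
rewrite (@gauss_stein _ (fun=> 1) (fun=> 0) A).
- by apply: eq_Rintegral => u _; rewrite mulr1.
- by move=> u; exact: cvg_cst.
- by move=> u; rewrite normr1.
- by move=> u; rewrite normr0 (le_trans _ (hA u)).
- move=> u; rewrite mulr1 -(expr1 `|u|) (le_trans (h1 u))// ler_wpM2r ?expR_ge0//.
  by rewrite /A (le_trans (ler_norm _))// lerDr.
Qed.

(** By [gauss_stein] the function F of t satisfies F' = - t F, so F exp (t^2
    / 2) is constant. *)
Lemma phase_cf_gauss (th t : R) :
  phase_cf gauss id th t = cos th * expR (- (t ^+ 2 / 2)).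
Proof.
pose F s := phase_cf gauss id th s.
have [A1 h1] := pow_le_quarter 1.
have q1 := @quarter_ge1 R.
have dF s : is_derive s (1 : R) F (- s * F s).
  have -> : - s * F s = \int[gauss]_u (- sin (th + s * u) * u).
    pose A := 1 + `|s| + `|A1|.
    have A1A u : `|u| <= A * quarter u.
      rewrite -(expr1 `|u|) (le_trans (h1 u))// ler_wpM2r ?expR_ge0//.
      by rewrite /A (le_trans (ler_norm _))// lerDr addr_ge0.
    have hA u (B : R) : `|B| <= 1 + `|s| -> `|B| <= A * quarter u.
      move=> h; rewrite (le_trans h)//.
      have := q1 u; have := normr_ge0 A1; have := normr_ge0 s; rewrite /A; nra.
    have stein : \int[gauss]_u (s * cos (th + s * u)) =
        \int[gauss]_u (u * sin (th + s * u)).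
      apply: (@gauss_stein _ (fun u => sin (th + s * u)) _ A).
      + by move=> u; derive_eq; rewrite /=; ring.
      + apply: (@is_derive_continuous _ _ (fun u => s * (- sin (th + s * u) * s))) => u.
        by derive_eq; rewrite /=; ring.
      + by move=> u; apply: hA; rewrite (le_trans (sin_max _))// lerDl.
      + move=> u; apply: hA; rewrite normrM (@le_trans _ _ `|s|)// ?lerDr//.
        by rewrite ler_piMr// cos_max.
      + move=> u; rewrite normrM (le_trans _ (A1A u))//.
        by rewrite ler_piMr// sin_max.
    rewrite /F /phase_cf -RintegralZl//; last exact: integrable_phase.
    transitivity (- \int[gauss]_u (s * cos (th + s * u))).
      rewrite !RintegralZl ?mulNr//; exact: integrable_phase.
    rewrite stein -mulN1r -RintegralZl//.
      by apply: eq_Rintegral => u _; rewrite mulrC mulrN1 mulrC mulNr.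
    apply: (@integrable_gauss _ _ A).
      apply: measurable_funM => //; apply: (measurableT_comp measurable_sin).
      by apply: measurable_funD => //; exact: measurable_funM.
    move=> u; rewrite normrM (le_trans _ (A1A u))//.
    by rewrite ler_piMr// sin_max.
  apply: (@is_derive_Rintegral _ _ _ gauss setT (fun s u => cos (th + s * u))
    (fun s u => - sin (th + s * u) * u) (fun u => `|u|)) => //.
  - by move=> x; exact: integrable_phase.
  - by move=> x u _; derive_eq; rewrite /=; ring.
  - by have := integrable_gauss_norm_pow 1; under eq_fun do rewrite expr1.
  - by move=> x u _; rewrite normrM normrN ler_piMl// sin_max.
have dH s : is_derive s (1 : R) (fun s => F s * expR (s ^+ 2 / 2)) 0.
  have dFs := dF s.
  by derive_eq; rewrite /=; field.
have := is_derive_0_is_cst t 0 dH.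
rewrite /= expr0n/= mul0r expR0 mulr1.
have -> : F 0 = cos th.
  rewrite /F /phase_cf; under eq_Rintegral do rewrite mul0r addr0.
  exact: Rintegral_cst_probability.
by move=> <-; rewrite -mulrA -expRD subrr expR0 mulr1.
Qed.

End gaussian_moments.

(** * Moments and low frequencies *)

Section moments.
Context {R : realType} (mu : probability (measurableTypeR R) R).

Lemma measurable_norm_pow j : measurable_fun setT (fun x : R => `|x| ^+ j).
Proof. by apply: measurable_funX; exact: normr_measurable. Qed.

Lemma pow_le_1D_pow (x : R) j n : (j <= n)%N -> 0 <= x -> x ^+ j <= 1 + x ^+ n.
Proof.
move=> jn x0; have [x1|/ltW x1] := leP x 1.
  by rewrite (le_trans (exprn_ile1 _ x0 x1))// lerDl exprn_ge0.
by rewrite (le_trans (ler_weXn2l x1 jn))// lerDr.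
Qed.

Lemma pow_convex (x : R) j : 0 <= x -> 2 * x ^+ j.+1 <= x ^+ j + x ^+ j.+2.
Proof.
move=> x0; rewrite !exprS.
by have := mulr_ge0 (exprn_ge0 j x0) (sqr_ge0 (x - 1)); lra.
Qed.

Variable n : nat.
Hypothesis intn : mu.-integrable setT (EFin \o (fun x : R => `|x| ^+ n)).

Lemma integrable_norm_pow j : (j <= n)%N ->
  mu.-integrable setT (EFin \o (fun x : R => `|x| ^+ j)).
Proof.
move=> jn; have i1 := rintegrableD measurableT
  (finite_measure_integrable_cst mu 1 measurableT) intn.
apply: le_integrable i1 => //.
  by apply/measurable_EFinP; exact: measurable_norm_pow.
move=> x _ /=; rewrite lee_fin ger0_norm ?exprn_ge0//.
exact: le_trans (pow_le_1D_pow jn (normr_ge0 x)) (ler_norm _).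
Qed.

Lemma integrable_pow j : (j <= n)%N ->
  mu.-integrable setT (EFin \o (fun x : R => x ^+ j)).
Proof.
move=> jn; apply: le_integrable (integrable_norm_pow jn) => //.
  by apply/measurable_EFinP; exact: measurable_exp.
by move=> x _ /=; rewrite lee_fin !normrX normr_id.
Qed.

Notation beta j := (\int[mu]_x `|x| ^+ j).

(** Convexity of the absolute moments in their order, by integrating
    [pow_convex]. *)
Lemma abs_moment_convex j : (j.+2 <= n)%N ->
  2 * beta j.+1 <= beta j + beta j.+2.
Proof.
move=> jn; have i0 := integrable_norm_pow (ltnW (ltnW jn)).
have i1 := integrable_norm_pow (ltnW jn); have i2 := integrable_norm_pow jn.
rewrite -RintegralZl// -RintegralD//; apply: le_Rintegral => //.
- exact: rintegrableZl.
- exact: rintegrableD.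
- by move=> x _; exact: pow_convex.
Qed.

Hypotheses (n2 : (2 <= n)%N) (var1 : \int[mu]_x x ^+ 2 = 1).

Lemma abs_moment0 : beta 0 = 1.
Proof. by under eq_Rintegral do rewrite expr0; exact: Rintegral_cst_probability. Qed.

Lemma abs_moment2 : beta 2 = 1.
Proof. by rewrite -var1; apply: eq_Rintegral => x _; rewrite real_normK ?num_real. Qed.

(** Convexity propagates upwards the first inequality, which holds since the
    moments of orders 0 and 2 are both 1. *)
Lemma abs_momentS j : (j.+2 <= n)%N -> beta j.+1 <= beta j.+2.
Proof.
elim: j => [|j IH] jn; have := abs_moment_convex jn.
  by rewrite abs_moment0 abs_moment2; lra.
by have := IH (ltnW jn); lra.
Qed.

Lemma abs_moment_le j l : (1 <= j <= l)%N -> (l <= n)%N -> beta j <= beta l.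
Proof.
case: j => // j /andP[_].
elim: l => // l IH; rewrite leq_eqVlt => /predU1P[-> //|jl] ln.
rewrite (le_trans (IH jl (ltnW ln)))//.
by case: l jl ln {IH} => // l _ ln; exact: abs_momentS.
Qed.

Lemma abs_moment_ge1 : 1 <= beta n.
Proof. by rewrite -abs_moment2; apply: abs_moment_le. Qed.

End moments.

Section taylor_cf.
Context {R : realType} (mu : probability (measurableTypeR R) R) (n : nat).
Hypothesis intn : mu.-integrable setT (EFin \o (fun x : R => `|x| ^+ n)).

Lemma phase_cf_taylor (th t : R) :
  `|phase_cf mu id th t -
    \sum_(j < n) cos (th + j%:R * (pi / 2)) / j`!%:R * t ^+ j * \int[mu]_x x ^+ j|
  <= `|t| ^+ n / n`!%:R * \int[mu]_x `|x| ^+ n.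
Proof.
pose c (j : nat) := cos (th + j%:R * (pi / 2)) / j`!%:R * t ^+ j.
have ij (j : 'I_n) : mu.-integrable setT (EFin \o (fun x : R => c j * x ^+ j)).
  by apply: rintegrableZl => //; apply: (integrable_pow intn); exact: ltnW.
have iS : mu.-integrable setT (EFin \o (fun x => cos_taylor th n (t * x))).
  have := integrable_sum measurableT (index_enum 'I_n) (P := xpredT) (fun j _ => ij j).
  apply: eq_integrable => // x _ /=.
  rewrite sumEFin; congr EFin; rewrite /cos_taylor; apply: eq_bigr => j _.
  by rewrite /c exprMn; ring.
have -> : \sum_(j < n) cos (th + j%:R * (pi / 2)) / j`!%:R * t ^+ j *
    \int[mu]_x x ^+ j = \int[mu]_x cos_taylor th n (t * x).
  transitivity (\sum_(j < n) \int[mu]_x (c j * x ^+ j)).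
    apply: eq_bigr => j _; rewrite RintegralZl//.
    by apply: (integrable_pow intn); exact: ltnW.
  apply: EFin_inj; rewrite -EFin_Rintegral// -sumEFin.
  transitivity (\sum_(j < n) \int[mu]_x (c j * x ^+ j)%:E)%E.
    by apply: eq_bigr => j _; rewrite EFin_Rintegral//; exact: ij.
  rewrite -integral_sum//; apply: eq_integral => x _.
  rewrite sumEFin; congr EFin; rewrite /cos_taylor; apply: eq_bigr => j _.
  by rewrite /c exprMn; ring.
have ic := integrable_phase mu (@measurable_id _ _ setT) th t.
rewrite /phase_cf -RintegralB//.
apply: le_trans (le_normr_Rintegral measurableT (rintegrableB measurableT ic iS)) _.
rewrite -RintegralZl//; apply: le_Rintegral => //.
- exact: (integrable_norm (rintegrableB measurableT ic iS)).
- exact: rintegrableZl.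
- move=> x _; apply: le_trans (cos_taylor_bound _ _ _) _.
  by rewrite normrM exprMn; lra.
Qed.

End taylor_cf.

Section matched_moments.
Context {R : realType} (mu : probability (measurableTypeR R) R) (k : nat).
Notation gauss := (@normal_prob R 0 1).
Hypothesis k3 : (3 <= k)%N.
Hypothesis intk : mu.-integrable setT (EFin \o (fun x : R => `|x| ^+ k.+1)).
Hypothesis moments : forall j, (1 <= j <= k)%N ->
  \int[mu]_x x ^+ j = \int[gauss]_u u ^+ j.
Notation M := (\int[mu]_x `|x| ^+ k.+1).

Let gauss0 : \int[gauss]_u u ^+ 0 = 1.
Proof. by under eq_Rintegral do rewrite expr0; exact: Rintegral_cst_probability. Qed.

Lemma matched_moment1 : \int[mu]_x x ^+ 1 = 0.
Proof.
rewrite moments ?(leq_trans _ k3)// -[RHS](@gauss_moment1 R).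
by apply: eq_Rintegral => u _; rewrite expr1.
Qed.

Lemma matched_moment2 : \int[mu]_x x ^+ 2 = 1.
Proof. by rewrite moments ?(leq_trans _ k3)// gauss_moment_rec gauss0 mulr1. Qed.

Lemma matched_moment3 : \int[mu]_x x ^+ 3 = 0.
Proof.
rewrite moments ?k3// gauss_moment_rec.
by rewrite -(moments (j := 1)) ?(leq_trans _ k3)// matched_moment1 mulr0.
Qed.

Lemma matched_abs_moment_ge1 : 1 <= M.
Proof.
apply: (abs_moment_ge1 intk); last exact: matched_moment2.
by rewrite ltnS (leq_trans _ k3).
Qed.

Lemma matched_even_moment_le j : ~~ odd j -> (1 <= j <= k)%N ->
  \int[gauss]_u u ^+ j <= M.
Proof.
move=> ej /andP[j1 jk]; rewrite -moments ?j1//.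
have -> : \int[mu]_x x ^+ j = \int[mu]_x `|x| ^+ j.
  by apply: eq_Rintegral => x _; rewrite -normrX ger0_norm// exprn_even_ge0.
by apply: (abs_moment_le intk matched_moment2) => //; rewrite j1 ltnW.
Qed.

(** The largest even moment of order at most k is shared with the law mu,
    hence at most M; one step of the Gaussian recursion costs a factor at
    most k. For even k the odd absolute moment is first bounded by the mean
    of its neighbours. *)
Lemma gauss_abs_moment_le : \int[gauss]_u `|u| ^+ k.+1 <= k%:R * M.
Proof.
have [ok|ek] := boolP (odd k).
  have -> : \int[gauss]_u `|u| ^+ k.+1 = \int[gauss]_u u ^+ k.+1.
    apply: eq_Rintegral => u _; rewrite -normrX ger0_norm//.
    by apply: exprn_even_ge0; rewrite /= ok.
  have kE : k = k.-1.+1 by case: k k3.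
  rewrite [in leLHS]kE gauss_moment_rec -kE ler_wpM2l//.
  apply: matched_even_moment_le; first by move: ok; rewrite [in X in X -> _]kE.
  by rewrite leq_pred andbT; case: k k3 => [|[]].
have gk := matched_even_moment_le ek (_ : (1 <= k <= k)%N).
have {}gk : \int[gauss]_u u ^+ k <= M by apply: gk; rewrite leqnn (leq_trans _ k3).
have i0 := integrable_gauss_pow (R := R) k.
have i2 := integrable_gauss_pow (R := R) k.+2.
have pt (u : R) : `|u| ^+ k.+1 <= 1 / 2 * (u ^+ k + u ^+ k.+2).
  have := pow_convex k (normr_ge0 u).
  have -> : `|u| ^+ k = u ^+ k by rewrite -normrX ger0_norm// exprn_even_ge0.
  have -> : `|u| ^+ k.+2 = u ^+ k.+2.
    by rewrite -normrX ger0_norm// exprn_even_ge0//= negbK.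
  by lra.
apply: (@le_trans _ _ (\int[gauss]_u (1 / 2 * (u ^+ k + u ^+ k.+2)))).
  apply: le_Rintegral => //.
  - exact: integrable_gauss_norm_pow.
  - by apply: rintegrableZl => //; exact: rintegrableD.
rewrite RintegralZl//; last exact: rintegrableD.
rewrite RintegralD// gauss_moment_rec.
have k3' : 3 <= k%:R :> R by rewrite ler_nat.
have M1 := matched_abs_moment_ge1.
have h : 1 / 2 * (1 + k.+1%:R) <= k%:R :> R by rewrite -(natr1 k); lra.
rewrite -[X in X + _]mul1r -mulrDl mulrA.
have g0 : 0 <= \int[gauss]_u u ^+ k.
  by apply: Rintegral_ge0 => u _; exact: exprn_even_ge0.
by apply: ler_pM => //; rewrite mulr_ge0// addr_ge0.
Qed.

(** The Taylor polynomials agree since the moments do, and the two remainders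
    add up to (1 + k) M / (k+1)! by [gauss_abs_moment_le]. *)
Lemma phase_cf_gauss_diff (th t : R) :
  `|phase_cf mu id th t - cos th * expR (- (t ^+ 2 / 2))|
  <= `|t| ^+ k.+1 * M / k`!%:R.
Proof.
have h1 := phase_cf_taylor intk th t.
have h2 := phase_cf_taylor (integrable_gauss_norm_pow (R := R) k.+1) th t.
rewrite phase_cf_gauss in h2.
have E : \sum_(j < k.+1) cos (th + j%:R * (pi / 2)) / j`!%:R * t ^+ j * \int[mu]_x x ^+ j
   = \sum_(j < k.+1) cos (th + j%:R * (pi / 2)) / j`!%:R * t ^+ j * \int[gauss]_x x ^+ j.
  apply: eq_bigr => -[[|j] /= jk] _; congr (_ * _); last by rewrite moments.
  by rewrite gauss0; under eq_Rintegral do rewrite expr0; exact: Rintegral_cst_probability.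
rewrite E in h1; move: h1 h2; set S := \sum_(_ < _) _ => h1 h2.
rewrite (le_trans (ler_distD S _ _))// (distrC S) (le_trans (lerD h1 h2))//.
rewrite -mulrDr factS natrM.
have f0 : 0 < k`!%:R :> R by rewrite ltr0n fact_gt0.
have k1 : 0 < k.+1%:R :> R by rewrite ltr0n.
have -> : `|t| ^+ k.+1 * M / k`!%:R =
    `|t| ^+ k.+1 / (k.+1%:R * k`!%:R) * (M + k%:R * M).
  rewrite -[X in X + _]mul1r -mulrDl addrC natr1; field.
  by rewrite gt_eqF// gt_eqF.
rewrite ler_wpM2l ?divr_ge0 ?exprn_ge0 ?mulr_ge0//.
by rewrite lerD2l gauss_abs_moment_le.
Qed.

(** Order four expansion: the first and third moments vanish, the second is
    1, and the fourth is at most M, so that t^2 M <= 1 turns the remainder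
    into t^2 / 24. *)
Lemma phase_cf_low (th t : R) : t ^+ 2 * M <= 1 ->
  `|phase_cf mu id th t| <= 1 - 11 / 24 * t ^+ 2.
Proof.
move=> tM; have M1 := matched_abs_moment_ge1.
have k4 : (4 <= k.+1)%N by [].
have h := phase_cf_taylor (integrable_norm_pow intk k4) th t.
rewrite !big_ord_recl big_ord0 /= /bump /= in h.
rewrite matched_moment1 matched_moment2 matched_moment3 in h.
have m0 : \int[mu]_x x ^+ 0 = 1.
  by under eq_Rintegral do rewrite expr0; exact: Rintegral_cst_probability.
rewrite m0 !mulr0 !mulr1 !addr0 !add0r mul0r addr0 in h.
have c2 : cos (th + (1 + 1)%:R * (pi / 2)) = - cos th.
  by rewrite (_ : _ * _ = pi) ?cosDpi//; field.
rewrite c2 in h.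
have E : cos th / 0`!%:R + - cos th / (1 + (1 + 0))`!%:R * t ^+ (1 + (1 + 0)) =
    cos th * (1 - t ^+ 2 / 2).
  by rewrite fact0 divr1 -[(1 + (1 + 0))%N]/2%N -[2`!]/2%N; field.
rewrite E -[4`!]/24%N in h.
have b4 : \int[mu]_x `|x| ^+ 4 <= M.
  exact: (abs_moment_le intk matched_moment2).
have t2 : t ^+ 2 <= 1 by have := sqr_ge0 t; nra.
have t4 : `|t| ^+ 4 * \int[mu]_x `|x| ^+ 4 <= t ^+ 2.
  have -> : `|t| ^+ 4 = t ^+ 2 * t ^+ 2 by rewrite -expr2 -exprM -normrX ger0_norm// exprn_even_ge0.
  have := sqr_ge0 t; move: (t ^+ 2) (\int[mu]_x _) b4 tM => a b; nra.
have c1 : `|cos th * (1 - t ^+ 2 / 2)| <= 1 - t ^+ 2 / 2.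
  rewrite normrM (ger0_norm (_ : 0 <= 1 - t ^+ 2 / 2)); last lra.
  by rewrite ler_piMl ?cos_max//; lra.
rewrite -[phase_cf _ _ _ _](subrK (cos th * (1 - t ^+ 2 / 2))).
by rewrite (le_trans (ler_normD _ _))// (le_trans (lerD h c1))//; lra.
Qed.

End matched_moments.

(** * High frequencies *)

Section high_frequencies.
Context {R : realType}.
Notation leb := (@lebesgue_measure R).

Lemma sin_le_taylor (x : R) : 0 <= x -> sin x <= x - x ^+ 3 / 6 + x ^+ 5 / 120.
Proof.
(* The phase - pi / 2 turns the cosine into the sine. *)
move=> x0; have := cos_taylor_bound 5 (- (pi / 2)) x.
rewrite /cos_taylor !big_ord_recl big_ord0 /= /bump /=.
rewrite (addrC _ x) cosBpihalf mul0r addr0 cosN cos_pihalf.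
have -> : - (pi / 2) + (1 + 0)%:R * (pi / 2) = 0 :> R by rewrite addn0; ring.
have -> : - (pi / 2) + (1 + (1 + 0))%:R * (pi / 2) = pi / 2 :> R.
  by rewrite -[(1 + (1 + 0))%N]/2%N; ring.
have -> : - (pi / 2) + (1 + (1 + (1 + 0)))%:R * (pi / 2) = pi :> R.
  by rewrite -[(1 + (1 + (1 + 0)))%N]/3%N; field.
have -> : - (pi / 2) + (1 + (1 + (1 + (1 + 0))))%:R * (pi / 2) = pi / 2 + pi :> R.
  by rewrite -[(1 + (1 + (1 + (1 + 0))))%N]/4%N; field.
rewrite cos0 cospi cos_pihalf (cosDpi (pi / 2)) cos_pihalf oppr0 !mul0r !addr0 !add0r.
rewrite -[(1 + 0)%N]/1%N -[(1 + (1 + (1 + 0)))%N]/3%N.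
rewrite -[1`!]/1%N -[3`!]/6%N -[5`!]/120%N (ger0_norm x0) expr1 divr1 mul1r.
rewrite ler_norml => /andP[_]; lra.
Qed.

(** For x <= 2 the fifth order Taylor polynomial suffices, for x >= 2 the
    bound |sin x| <= 1. *)
Lemma norm_sin_le (x x0 : R) : 0 < x0 -> x0 <= 1 / 2 -> x0 <= x ->
  `|sin x| <= x * (1 - x0 ^+ 2 / 12).
Proof.
move=> x00 x0h x0x; have xpos : 0 < x := lt_le_trans x00 x0x.
have x02 : x0 ^+ 2 <= 1 / 4 by rewrite expr2; nra.
have [x2|x2] := leP 2 x.
  by rewrite (le_trans (sin_max x))//; nra.
rewrite ger0_norm; last by apply/ltW/sin2_gt0; rewrite xpos.
apply: le_trans (sin_le_taylor (ltW xpos)) _.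
have x0x2 : x0 ^+ 2 <= x ^+ 2 by rewrite ler_sqr ?nnegrE ?(ltW xpos) ?(ltW x00).
have xx : x ^+ 2 <= 4 by rewrite expr2; nra.
have -> : x - x ^+ 3 / 6 + x ^+ 5 / 120 = x * (1 - x ^+ 2 / 6 + x ^+ 2 * x ^+ 2 / 120).
  by ring.
rewrite ler_pM2l//.
by have := sqr_ge0 x; move: (x ^+ 2) x0x2 xx => y; nra.
Qed.

(** The singular part and the density outside the interval only add to the
    integral of a nonnegative function. *)
Lemma assumption1_minorization (h w : R) (mu : {measure set (measurableTypeR R) -> \bar R}) :
  0 <= h -> assumption1 h w mu ->
  exists a : R, forall g : R -> R, measurable_fun setT g -> (forall x, 0 <= g x) ->
    (\int[leb]_(x in `[a, (a + w)%R]) (h * g x)%R%:E <= \int[mu]_x (g x)%:E)%E.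
Proof.
move=> h0 [mud [mus [f [[muE _ _] [mf f0 fE] [a fa]]]]]; exists a => g mg g0.
have -> : (\int[mu]_x (g x)%:E = \int[measure_add mud mus]_x (g x)%:E)%E.
  by apply: eq_measure_integral => A mA _; rewrite muE//; exact/esym/measure_addE.
rewrite ge0_integral_measure_add//; last 2 first.
  by move=> x _; rewrite lee_fin.
  exact/measurable_EFinP.
rewrite (ge0_integral_density mf f0 fE mg g0).
apply: (@le_trans _ _ (\int[leb]_x (g x * f x)%R%:E)%E); last first.
  by rewrite leeDl// integral_ge0// => x _; rewrite lee_fin.
have mgf : measurable_fun setT (fun x => (g x * f x)%R%:E).
  by apply/measurable_EFinP; exact: measurable_funM.
have mhg : measurable_fun setT (fun x => (h * g x)%R%:E).
  by apply/measurable_EFinP; exact: measurable_funM.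
rewrite -integral_itv_bndo_bndc; last exact: measurable_funTS.
apply: (@le_trans _ _ (\int[leb]_(x in `[a, (a + w)%R[) (g x * f x)%R%:E)%E).
  apply: ge0_le_integral => //=.
  - by move=> x _; rewrite lee_fin mulr_ge0.
  - exact: measurable_funTS.
  - exact: measurable_funTS.
  - move=> x; rewrite in_itv/= => xa; rewrite lee_fin mulrC ler_wpM2l//.
    exact: fa.
apply: ge0_subset_integral => //.
by move=> x _; rewrite lee_fin mulr_ge0.
Qed.

(** Integrate the nonnegative function 1 - cos (th + s u) against h times
    Lebesgue measure on the interval: the result is h (w - 2 |sin (s w / 2)|
    / s) at least, and [norm_sin_le] compares the sine with s w / 2. *)
Lemma phase_cf_high (h w : R) (mu : probability (measurableTypeR R) R) (th s s0 : R) :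
  0 < h -> 0 < w <= 1 -> assumption1 h w mu -> 0 < s0 <= 1 -> s0 <= s ->
  phase_cf mu id th s <= 1 - h * w ^+ 3 * s0 ^+ 2 / 48.
Proof.
move=> h0 /andP[w0 w1] /(assumption1_minorization (ltW h0))[a ha] /andP[s00 s01] s0s.
have s_gt0 : 0 < s := lt_le_trans s00 s0s.
pose g (u : R) := 1 - cos (th + s * u).
have dS u : is_derive u (1 : R) (fun u => h * (u - sin (th + s * u) / s)) (h * g u).
  derive_eq; rewrite /= /g; field.
  by rewrite gt_eqF.
have cg : continuous (fun u => h * g u).
  apply: (@is_derive_continuous _ _ (fun u => h * (sin (th + s * u) * s))) => u.
  by rewrite /g; derive_eq; rewrite /=; ring.
have mg : measurable_fun setT g.
  by apply: measurable_funB => //; apply: (@measurable_phase _ _ _ id).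
have g0 u : 0 <= g u by rewrite subr_ge0 cos_le1.
have ip := integrable_phase mu (@measurable_id _ _ setT) th s.
have ig : mu.-integrable setT (EFin \o g).
  by apply: rintegrableB => //; exact: finite_measure_integrable_cst.
have gE : \int[mu]_x g x = 1 - phase_cf mu id th s.
  by rewrite RintegralB ?Rintegral_cst_probability//; exact: finite_measure_integrable_cst.
have aw : a <= a + w by rewrite lerDl ltW.
have := ha g mg g0; rewrite (EFin_Rintegral measurableT ig) gE.
rewrite EFin_Rintegral//; last first.
  apply: continuous_compact_integrable; first exact: segment_compact.
  exact: continuous_subspaceT.
rewrite lee_fin (Rintegral_derive aw dS cg) => H.
pose x := s * w / 2.
have Hs : sin (th + s * (a + w)) - sin (th + s * a) <= 2 * `|sin x|.
  have -> : th + s * (a + w) = (th + s * a + x) + x by rewrite /x; field.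
  rewrite {2}(_ : th + s * a = (th + s * a + x) - x); last by rewrite addrK.
  rewrite sinD sinB; set y := th + _ + x.
  have -> : sin y * cos x + cos y * sin x - (sin y * cos x - cos y * sin x) =
    2 * (cos y * sin x) by ring.
  by rewrite ler_pM2l// (le_trans (ler_norm _))// normrM ler_piMl// cos_max.
have Hx : `|sin x| <= x * (1 - (s0 * w / 2) ^+ 2 / 12).
  apply: norm_sin_le; rewrite /x.
  - by rewrite !mulr_gt0.
  - by nra.
  - by rewrite ler_pM2r// ler_pM2r.
have : (sin (th + s * (a + w)) - sin (th + s * a)) / s <= w * (1 - (s0 * w / 2) ^+ 2 / 12).
  rewrite ler_pdivrMr// (le_trans Hs)//.
  by move: Hx; rewrite /x; lra.
move=> K; have := ler_wpM2l (ltW h0) K.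
move: H; rewrite mulrBl; lra.
Qed.

End high_frequencies.

(** * Cauchy smoothing *)

Section cauchy_kernel.
Context {R : realType}.
Notation leb := (@lebesgue_measure R).
Variables (sig : R) (sig0 : 0 < sig).

Let cexp : continuous (fun t : R => expR (- (sig * t))).
Proof.
apply: (@is_derive_continuous _ _ (fun t => expR (- (sig * t)) * - sig)) => t.
by derive_eq; rewrite /=; ring.
Qed.

Let mexp : measurable_fun setT (fun t : R => expR (- (sig * t))).
Proof. exact: continuous_measurable_fun. Qed.

Let cvg_exp_y : expR (- (sig * t)) @[t --> +oo] --> (0 : R).
Proof.
apply: (cvg_comp (fun t : R => sig * t) (fun x => expR (- x)) _ (@cvgr_expR R)).
exact: (gt0_cvgMry sig0 cvg_id).
Qed.

Lemma integral_exp_decay :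
  (\int[leb]_(t in `[0%R, +oo[) (expR (- (sig * t)))%:E = (sig^-1)%:E)%E.
Proof.
have dF (t : R) : is_derive t (1 : R) (fun t => - (expR (- (sig * t)) / sig))
    (expR (- (sig * t))).
  by derive_eq; rewrite /=; field; rewrite gt_eqF.
have cF := is_derive_continuous dF.
rewrite (@ge0_continuous_FTC2y _ _ (fun t => - (expR (- (sig * t)) / sig)) 0 0).
- by rewrite mulr0 oppr0 expR0 div1r sub0e EFinN oppeK.
- by move=> t _; exact: expR_ge0.
- exact: continuous_subspaceT.
- rewrite -oppr0 -(mul0r sig^-1); apply: cvgN; apply: cvgM => //; exact: cvg_cst.
- by move=> t _; have [] := dF t.
- by apply: cvg_at_right_filter; exact: cF.
- by move=> t _; rewrite derive1E; have [] := dF t.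
Qed.

Lemma integrable_exp_decay :
  leb.-integrable `[0, +oo[ (EFin \o (fun t => expR (- (sig * t)))).
Proof.
apply/integrableP; split; first by apply/measurable_EFinP; exact: measurable_funTS.
under eq_integral do rewrite /= ger0_norm ?expR_ge0//.
by rewrite integral_exp_decay ltry.
Qed.

(** The real part of the Laplace transform of exp (i t y). *)
Lemma Rintegral_cos_exp (y : R) :
  \int[leb]_(t in `]0, +oo[) (cos (t * y) * expR (- (sig * t))) =
  sig / (sig ^+ 2 + y ^+ 2).
Proof.
have D0 : 0 < sig ^+ 2 + y ^+ 2 by rewrite ltr_pwDl ?exprn_gt0// sqr_ge0.
pose f t := cos (t * y) * expR (- (sig * t)).
pose F t := expR (- (sig * t)) * (y * sin (t * y) - sig * cos (t * y)) /
            (sig ^+ 2 + y ^+ 2).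
have dF (t : R) : is_derive t (1 : R) F (f t).
  rewrite /F /f; derive_eq; rewrite /=; field.
  by rewrite gt_eqF.
have cf : continuous f.
  apply: (@is_derive_continuous _ _ (fun t =>
    - sin (t * y) * y * expR (- (sig * t)) + cos (t * y) * (expR (- (sig * t)) * - sig))) => t.
  by rewrite /f; derive_eq; rewrite /=; ring.
have i_f : leb.-integrable `[0, +oo[ (EFin \o f).
  apply: le_integrable integrable_exp_decay => //.
    by apply/measurable_EFinP/measurable_funTS; exact: continuous_measurable_fun.
  move=> t _ /=; rewrite lee_fin /f normrM (ger0_norm (expR_ge0 _)).
  by rewrite ler_piMl ?expR_ge0// cos_max.
rewrite Rintegral_itv_obnd_cbnd; last first.
  apply: integrableS i_f => //.
  by move=> t /=; rewrite !in_itv/= !andbT; exact: ltW.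
apply: (@improper_Rintegral_derive _ _ (fun=> 0) (fun n => n%:R) F f) => //.
- by move=> n t /=; rewrite !in_itv/= andbT => /andP[].
- move=> t; rewrite /= in_itv/= andbT => t0; near=> n.
  by rewrite t0; near: n; exact: nbhs_infty_ger.
- have F0 : F 0 = - (sig / (sig ^+ 2 + y ^+ 2)).
    by rewrite /F mulr0 mul0r oppr0 expR0 sin0 cos0; ring.
  have -> : sig / (sig ^+ 2 + y ^+ 2) = 0 - F 0 by rewrite F0 sub0r opprK.
  apply: cvgB; last exact: cvg_cst.
  pose C := (`|y| + sig) / (sig ^+ 2 + y ^+ 2).
  have FC (n : nat) : `|F n%:R| <= C * expR (- (sig * n%:R)).
    rewrite /F /C normrM (ger0_norm (_ : 0 <= (sig ^+ 2 + y ^+ 2)^-1)); last first.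
      by rewrite invr_ge0 ltW.
    rewrite normrM (ger0_norm (expR_ge0 _)).
    rewrite (mulrAC _ (_ ^-1)) (mulrC (_ + sig)).
    rewrite ler_wpM2r ?invr_ge0 ?(ltW D0)// ler_wpM2l ?expR_ge0//.
    rewrite (le_trans (ler_normB _ _))// !normrM (gtr0_norm sig0).
    rewrite lerD//; first by rewrite ler_piMr// sin_max.
    by rewrite ler_piMr ?(ltW sig0)// cos_max.
  apply: (@squeeze_cvgr _ _ _ _ (fun n => - C * expR (- (sig * n%:R)))
      (fun n => C * expR (- (sig * n%:R)))).
  + by apply: nearW => n; rewrite mulNr -ler_norml.
  + rewrite -[X in _ --> X](mulr0 (- C)).
    by apply: cvgM; [exact: cvg_cst|exact: cvg_expR_decay].
  + rewrite -[X in _ --> X](mulr0 C).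
    by apply: cvgM; [exact: cvg_cst|exact: cvg_expR_decay].
Unshelve. all: by end_near. Qed.

Lemma norm_sin_le_norm (x : R) : `|sin x| <= `|x|.
Proof.
have := cos_taylor_bound 1 (- (pi / 2)) x.
rewrite /cos_taylor big_ord_recl big_ord0 /= mul0r !addr0 expr0 mulr1 cosN cos_pihalf.
by rewrite mul0r subr0 expr1 -[1`!]/1%N divr1 addrC cosBpihalf.
Qed.

Definition sinc_kernel (t : R) : R := t^-1 * expR (- (sig * t)).

Lemma measurable_sinc_kernel : measurable_fun (`]0, +oo[%classic : set R) sinc_kernel.
Proof.
apply: open_continuous_measurable_fun => [|t]; first exact: interval_open.
rewrite inE/= in_itv/= andbT => t0; apply: cvgM; last exact: cexp.
by apply: cvgV; [rewrite gt_eqF|exact: cvg_id].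
Qed.

Lemma sinc_kernel_bound (t y : R) : 0 < t ->
  `|sin (t * y) * sinc_kernel t| <= `|y| * expR (- (sig * t)).
Proof.
move=> t0; rewrite /sinc_kernel normrM (ger0_norm (_ : 0 <= t^-1 * _)); last first.
  by rewrite mulr_ge0 ?expR_ge0// invr_ge0 ltW.
rewrite mulrA ler_wpM2r ?expR_ge0// ler_pdivrMr//.
by rewrite (le_trans (norm_sin_le_norm _))// normrM (gtr0_norm t0) mulrC.
Qed.

Lemma integrable_sinc_kernel (y : R) :
  leb.-integrable `]0, +oo[ (EFin \o (fun t => sin (t * y) * sinc_kernel t)).
Proof.
have i1 : leb.-integrable `]0, +oo[ (EFin \o (fun t => `|y| * expR (- (sig * t)))).
  apply: rintegrableZl => //; apply: integrableS integrable_exp_decay => //.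
  by move=> t /=; rewrite !in_itv/= !andbT; exact: ltW.
apply: le_integrable i1 => //.
  apply/measurable_EFinP; apply: measurable_funM.
    apply: measurable_funTS; apply: (measurableT_comp measurable_sin).
    exact: measurable_funM.
  exact: measurable_sinc_kernel.
move=> t /=; rewrite in_itv/= andbT => t0; rewrite lee_fin.
by rewrite (le_trans (sinc_kernel_bound y t0))// ler_norm.
Qed.

(** Differentiating under the integral in y gives [Rintegral_cos_exp], which
    is the derivative of atan (y / sig); both sides vanish at y = 0. *)
Lemma atan_sinc_kernel (y : R) :
  \int[leb]_(t in `]0, +oo[) (sin (t * y) * sinc_kernel t) = atan (y / sig).
Proof.
pose F y := \int[leb]_(t in `]0, +oo[) (sin (t * y) * sinc_kernel t).
have dF x : is_derive x (1 : R) F (sig / (sig ^+ 2 + x ^+ 2)).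
  rewrite -Rintegral_cos_exp.
  apply: (@is_derive_Rintegral _ _ _ leb _ (fun y t => sin (t * y) * sinc_kernel t)
    (fun y t => cos (t * y) * expR (- (sig * t))) (fun t => expR (- (sig * t)))) => //.
  - exact: integrable_sinc_kernel.
  - move=> z t; rewrite /= in_itv/= andbT => t0; rewrite /sinc_kernel.
    by derive_eq; rewrite /=; field; rewrite gt_eqF.
  - apply: integrableS integrable_exp_decay => //.
    by move=> t /=; rewrite !in_itv/= !andbT; exact: ltW.
  - move=> z t _; rewrite normrM (ger0_norm (expR_ge0 _)).
    by rewrite ler_piMl ?expR_ge0// cos_max.
have dH x : is_derive x (1 : R) (fun x => F x - atan (x / sig)) 0.
  have dFx := dF x; derive_eq; rewrite /=; field.
  by rewrite !gt_eqF// ltr_pwDl ?exprn_gt0// sqr_ge0.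
have := is_derive_0_is_cst y 0 dH.
have -> : F 0 = 0.
  rewrite /F; under eq_Rintegral do rewrite mulr0 sin0 mul0r.
  by rewrite Rintegral_cst// mul0r.
by rewrite mul0r atan0 subr0 => /eqP; rewrite subr_eq0 => /eqP.
Qed.

End cauchy_kernel.

Section smoothed_law.
Context {R : realType}.
Notation leb := (@lebesgue_measure R).
Variables (sig : R) (sig0 : 0 < sig).
Notation D := (`]0%R, +oo[%classic : set R).

Section one_law.
Context (nu : probability (measurableTypeR R) R).
Hypothesis inu : nu.-integrable setT (EFin \o (fun u : R => `|u|)).
Variable x : R.

Let q : R -> R := (sinc_kernel sig) \_ D.

Let mq : measurable_fun setT q.
Proof.
apply/(@measurable_restrict _ _ _ _ D setT) => //.
by rewrite setTI; exact: measurable_sinc_kernel.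
Qed.

Let f (z : R * R) : \bar R := (sin (z.2 * (x - z.1)) * q z.2)%:E.

Let mf : measurable_fun setT f.
Proof.
apply/measurable_EFinP; apply: measurable_funM; last exact: measurableT_comp.
apply: (measurableT_comp measurable_sin); apply: measurable_funM => //.
exact: measurable_funB.
Qed.

Let fE u t : f (u, t) = ((EFin \o (fun t => sin (t * (x - u)) * sinc_kernel sig t)) \_ D) t.
Proof. by rewrite /f /q /= !patchE; case: ifP => //; rewrite mulr0. Qed.

Let inner_t u : (\int[leb]_t f (u, t) = (atan ((x - u) / sig))%:E)%E.
Proof.
under eq_integral do rewrite fE.
rewrite -integral_mkcond EFin_Rintegral//; last exact: integrable_sinc_kernel.
by rewrite atan_sinc_kernel.
Qed.

Let inner_abs_t u : (\int[leb]_t `|f (u, t)| <= (`|x - u| / sig)%:E)%E.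
Proof.
have -> : (\int[leb]_t `|f (u, t)| = \int[leb]_(t in D)
    `|(sin (t * (x - u)) * sinc_kernel sig t)%:E|)%E.
  rewrite [RHS]integral_mkcond; apply: eq_integral => t _.
  by rewrite fE /= !patchE; case: ifP => // _; rewrite abse0.
apply: (@le_trans _ _ (\int[leb]_(t in `[0%R, +oo[)
    (`|x - u|%:E * (expR (- (sig * t)))%:E))%E); last first.
  have /integrableP[me _] := integrable_exp_decay sig0.
  by rewrite ge0_integralZl// integral_exp_decay.
have me : measurable_fun (`[0%R, +oo[%classic : set R)
    (fun t => (`|x - u|%:E * (expR (- (sig * t)))%:E)%E).
  have /integrableP[me _] := integrable_exp_decay sig0.
  exact: emeasurable_funM.
apply: (@le_trans _ _ (\int[leb]_(t in D)
    (`|x - u|%:E * (expR (- (sig * t)))%:E))%E).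
  apply: ge0_le_integral => //.
  - have /integrableP[mk _] := integrable_sinc_kernel sig0 (x - u).
    exact: measurableT_comp.
  - apply: measurable_funS me => //.
    by move=> t /=; rewrite !in_itv/= !andbT; exact: ltW.
  - by move=> t /=; rewrite in_itv/= andbT => t0; rewrite lee_fin sinc_kernel_bound.
apply: ge0_subset_integral => //.
by move=> t /=; rewrite !in_itv/= !andbT; exact: ltW.
Qed.

Let imf : (nu \x leb)%E.-integrable setT f.
Proof.
apply/integrable12ltyP => //.
have i1 : nu.-integrable setT (EFin \o (fun u : R => sig^-1 * (`|x| + `|u|))).
  apply: rintegrableZl => //; apply: rintegrableD => //.
  exact: finite_measure_integrable_cst.
apply: le_lt_trans (integrable_lty measurableT i1).
apply: ge0_le_integral => //.
- by move=> u _; exact: integral_ge0.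
- apply: (@measurable_fun_fubini_tonelli_F _ _ (measurableTypeR R) (measurableTypeR R) R leb
    (abse \o f)).
    exact: measurableT_comp.
  by move=> z; exact: abse_ge0.
- exact: measurable_int i1.
- move=> u _; apply: le_trans (inner_abs_t u) _.
  by rewrite lee_fin /= mulrC ler_wpM2l ?invr_ge0 ?(ltW sig0)// ler_normB.
Qed.

Let S t : R := \int[nu]_u sin (t * (x - u)).

Let sin_int t : nu.-integrable setT (EFin \o (fun u : R => sin (t * (x - u)))).
Proof.
apply: (@bounded_integrable _ _ _ _ _ 1); last by move=> u; exact: sin_max.
apply: (measurableT_comp measurable_sin); apply: measurable_funM => //.
exact: measurable_funB.
Qed.

Let inner_u t : (\int[nu]_u f (u, t) = (S t * q t)%:E)%E.
Proof.
rewrite /S -RintegralZr// -EFin_Rintegral//; last exact: rintegrableZr.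
Qed.

Lemma integrable_smoothed :
  leb.-integrable D (EFin \o (fun t => (\int[nu]_u sin (t * (x - u))) * sinc_kernel sig t)).
Proof.
apply/integrable_mkcond => //.
have : leb.-integrable setT (fun t => \int[nu]_u f (u, t))%E.
  apply/integrableP; split; first exact: (measurable_fubini_G imf).
  have H := (integrable21ltyP nu leb mf).1 imf. apply: (le_lt_trans _ H).
  apply: ge0_le_integral => //.
  - by apply: measurableT_comp => //; exact: (measurable_fubini_G imf).
  - apply: (@measurable_fun_fubini_tonelli_G _ _ (measurableTypeR R)
      (measurableTypeR R) R nu (abse \o f)).
      exact: measurableT_comp.
    by move=> z; exact: abse_ge0.
  - move=> t _; apply: le_abse_integral => //.
    exact: measurableT_comp.
apply: eq_integrable => // t _.
by rewrite inner_u /q /= !patchE; case: ifP => //; rewrite mulr0.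
Qed.

(** Fubini applied to [atan_sinc_kernel]; the first moment of nu provides the
    joint integrability. *)
Lemma smoothed_fourier :
  \int[nu]_u atan ((x - u) / sig) =
  \int[leb]_(t in D) ((\int[nu]_u sin (t * (x - u))) * sinc_kernel sig t).
Proof.
congr fine; transitivity (\int[leb]_t \int[nu]_u f (u, t))%E.
  rewrite -Fubini//; apply: eq_integral => u _; exact/esym/inner_t.
rewrite [RHS]integral_mkcond; apply: eq_integral => t _.
by rewrite inner_u /q /= !patchE; case: ifP => //; rewrite mulr0.
Qed.

End one_law.

(** A sine integral is a phase characteristic function: sin (t (x - u)) = cos
    (pi / 2 - t x + t u). *)
Lemma smoothed_diff_le (nu1 nu2 : probability (measurableTypeR R) R) (x B : R)
    (G : R -> R) :
  nu1.-integrable setT (EFin \o (fun u : R => `|u|)) ->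
  nu2.-integrable setT (EFin \o (fun u : R => `|u|)) ->
  leb.-integrable D (EFin \o G) -> \int[leb]_(t in D) G t <= B ->
  (forall th t, 0 < t -> `|phase_cf nu1 id th t - phase_cf nu2 id th t| *
      sinc_kernel sig t <= G t) ->
  `|\int[nu1]_u atan ((x - u) / sig) - \int[nu2]_u atan ((x - u) / sig)| <= B.
Proof.
move=> i1 i2 iG GB cfG.
have j1 := integrable_smoothed i1 x; have j2 := integrable_smoothed i2 x.
rewrite !smoothed_fourier// -RintegralB//.
apply: le_trans (le_normr_Rintegral _ (rintegrableB _ j1 j2)) _ => //.
apply: le_trans GB; apply: le_Rintegral => //.
  exact: (integrable_norm (rintegrableB _ j1 j2)).
move=> t; rewrite /= in_itv/= andbT => t0.
rewrite -mulrBl normrM (ger0_norm (_ : 0 <= sinc_kernel sig t)); last first.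
  by rewrite mulr_ge0 ?expR_ge0// invr_ge0 ltW.
apply: le_trans (cfG (pi / 2 - t * x) t t0).
have sE (nu : probability (measurableTypeR R) R) :
    \int[nu]_u sin (t * (x - u)) = phase_cf nu id (pi / 2 - t * x) t.
  apply: eq_Rintegral => u _; rewrite -cosBpihalf -cosN; congr cos; ring.
by rewrite !sE.
Qed.

End smoothed_law.

Section unsmoothing.
Context {R : realType}.

(** The function atan t + 1 / t decreases to its limit pi / 2. If its value v
    at y were below pi / 2, then at tan v it would be v + 1 / tan v > v,
    although tan v > y. *)
Lemma atan_lower_bound (y : R) : 0 < y -> pi / 2 - y^-1 <= atan y.
Proof.
move=> y0; rewrite leNgt; apply/negP => H.
pose v := atan y + y^-1.
have yV : 0 < y^-1 by rewrite invr_gt0.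
have v_ub : v < pi / 2 by rewrite /v; lra.
have v_lb : - (pi / 2) < v by have := atan_gtNpi2 y; rewrite /v; lra.
pose z := tan v.
have zv : atan z = v by rewrite /z tanK// in_itv/= v_lb v_ub.
have yz : y < z.
  rewrite ltNge; apply/negP => /le_atan; rewrite zv /v; lra.
have dh (t : R) : 0 < t -> is_derive t (1 : R) (fun t => atan t + t^-1)
    ((1 + t ^+ 2)^-1 * 1 + (- t ^- 2 * 1)).
  move=> t0.
  exact: (drv_D (drv_atan (drv_id t)) (drv_inv (lt0r_neq0 t0) (drv_id t))).
have cf : {within `[y, z], continuous (fun t : R => atan t + t^-1)}.
  apply: derivable_within_continuous => t; rewrite in_itv/= => /andP[yt _].
  by have [] := dh t (lt_le_trans y0 yt).
have dh' (t : R) : t \in `]y, z[ -> is_derive t (1 : R) (fun t => atan t + t^-1)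
    ((1 + t ^+ 2)^-1 * 1 + (- t ^- 2 * 1)).
  by rewrite in_itv/= => /andP[yt _]; apply: dh; exact: lt_trans yt.
have [t /[!in_itv]/= /andP[yt _] E] := MVT yz dh' cf.
have t0 : 0 < t := lt_trans y0 yt.
have neg : (1 + t ^+ 2)^-1 * 1 + (- t ^- 2 * 1) <= 0.
  rewrite !mulr1 subr_le0 lef_pV2 ?posrE ?exprn_gt0// ?lerDr//.
  by rewrite ltr_pwDl// sqr_ge0.
have zV : 0 < z^-1 by rewrite invr_gt0 (lt_trans y0).
have := mulr_le0_ge0 neg (ltW (_ : 0 < z - y)).
rewrite -E zv /v subr_gt0 => /(_ yz); lra.
Qed.

Variables (sig r : R) (sig0 : 0 < sig) (r0 : 0 < r).

Definition cauchy_cdf (y : R) : R := 1 / 2 + atan (y / sig) / pi.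

Let pi0 : 0 < pi :> R := pi_gt0 R.

Lemma cauchy_cdf_ge0 y : 0 <= cauchy_cdf y.
Proof.
have := atan_gtNpi2 (y / sig); rewrite /cauchy_cdf => h.
rewrite -(ler_pM2r pi0) mul0r mulrDl divfK ?gt_eqF//; lra.
Qed.

Lemma cauchy_cdf_le1 y : cauchy_cdf y <= 1.
Proof.
have := atan_ltpi2 (y / sig); rewrite /cauchy_cdf => h.
rewrite -(ler_pM2r pi0) mul1r mulrDl divfK ?gt_eqF//; lra.
Qed.

Notation tau := (sig / (pi * r)).

Lemma cauchy_cdf_right y : r <= y -> 1 - tau <= cauchy_cdf y.
Proof.
move=> ry; have y0 : 0 < y := lt_le_trans r0 ry.
have h : pi / 2 - sig / r <= atan (y / sig).
  apply: le_trans (atan_lower_bound (divr_gt0 y0 sig0)).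
  by rewrite lerD2l lerN2 invf_div ler_wpM2l ?(ltW sig0)// lef_pV2 ?posrE.
rewrite /cauchy_cdf -(ler_pM2r pi0) [leRHS]mulrDl divfK ?gt_eqF//.
have -> : (1 - tau) * pi = pi - sig / r.
  by move: pi0; move: (pi : R) => p p0; field; rewrite !gt_eqF.
lra.
Qed.

Lemma cauchy_cdfN y : cauchy_cdf (- y) = 1 - cauchy_cdf y.
Proof. by rewrite /cauchy_cdf mulNr atanN mulNr; lra. Qed.

Lemma cauchy_cdf_left y : y <= - r -> cauchy_cdf y <= tau.
Proof.
rewrite lerNr => ry; have := cauchy_cdf_right ry.
rewrite cauchy_cdfN; lra.
Qed.

Section one_law.
Context (nu : probability (measurableTypeR R) R).

Notation K x := (\int[nu]_u cauchy_cdf (x - u)).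
Notation F x := (fine (nu `]-oo, x]%classic)).

Let m_atan : measurable_fun setT (@atan R).
Proof. by apply: continuous_measurable_fun => x; exact: continuous_atan. Qed.

Let m_atan_shift x : measurable_fun setT (fun u : R => atan ((x - u) / sig)).
Proof.
apply: (measurableT_comp m_atan); apply: measurable_funM => //.
exact: measurable_funB.
Qed.

Let i_atan x : nu.-integrable setT (EFin \o (fun u : R => atan ((x - u) / sig))).
Proof.
apply: (@bounded_integrable _ _ _ _ _ (pi / 2)); first exact: m_atan_shift.
by move=> u; rewrite ler_norml (ltW (atan_gtNpi2 _)) (ltW (atan_ltpi2 _)).
Qed.

Let i_K x : nu.-integrable setT (EFin \o (fun u : R => cauchy_cdf (x - u))).
Proof.
apply: rintegrableD => //; first exact: finite_measure_integrable_cst.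
exact: rintegrableZr.
Qed.

Lemma cauchy_cdf_integral x :
  K x = 1 / 2 + (\int[nu]_u atan ((x - u) / sig)) / pi.
Proof.
rewrite /cauchy_cdf RintegralD//; last 2 first.
  exact: finite_measure_integrable_cst.
  exact: rintegrableZr.
by rewrite Rintegral_cst_probability RintegralZr.
Qed.

Let i_1 x : nu.-integrable setT (EFin \o (\1_`]-oo, x]%classic : R -> R)).
Proof.
apply: (@bounded_integrable _ _ _ _ _ 1); first exact: measurable_indic.
by move=> u; rewrite indicE; case: (_ \in _); rewrite ?normr1 ?normr0.
Qed.

Let F_indic x : \int[nu]_u \1_`]-oo, x]%classic u = F x.
Proof. by rewrite /Rintegral integral_indic// setIT. Qed.

(** Shifting by r to the right puts the step at x inside the region where the
    Cauchy distribution function is at least 1 - tau. *)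
Lemma cdf_le_smoothed x : F x <= K (x + r) + tau.
Proof.
rewrite -F_indic -[tau](Rintegral_cst_probability nu) -RintegralD//; last first.
  exact: finite_measure_integrable_cst.
apply: le_Rintegral => //.
  by apply: rintegrableD => //; exact: finite_measure_integrable_cst.
move=> u _; rewrite indicE mem_setE in_itv/=.
have tau0 : 0 <= tau by rewrite divr_ge0 ?mulr_ge0 ?ltW.
have [ux|_] := leP u x; last by rewrite addr_ge0// cauchy_cdf_ge0.
have := @cauchy_cdf_right (x + r - u).
by rewrite (_ : r <= _); [move=> /(_ isT) /=; lra|lra].
Qed.

Lemma smoothed_le_cdf x : K (x - r) <= F x + tau.
Proof.
rewrite -F_indic -[tau](Rintegral_cst_probability nu) -RintegralD//; last first.
  exact: finite_measure_integrable_cst.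
apply: le_Rintegral => //.
  by apply: rintegrableD => //; exact: finite_measure_integrable_cst.
move=> u _; rewrite indicE mem_setE in_itv/=.
have tau0 : 0 <= tau by rewrite divr_ge0 ?mulr_ge0 ?ltW.
have [ux|ux] := leP u x.
  by rewrite (le_trans (cauchy_cdf_le1 _))//= lerDl.
by rewrite /= add0r; apply: cauchy_cdf_left; lra.
Qed.

End one_law.

(** Sandwich: each distribution function lies between the smoothed ones
    shifted by r, and passing from x - 2 r to x + 2 r changes the second by
    its modulus of continuity only. *)
Lemma cdf_diff_le (nu1 nu2 : probability (measurableTypeR R) R) (D c : R) :
  (forall x, `|\int[nu1]_u atan ((x - u) / sig) -
               \int[nu2]_u atan ((x - u) / sig)| <= D) ->
  (forall a b, a <= b -> (nu2 `]a, b]%classic <= (c * (b - a))%:E)%E) ->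
  forall x, (`|nu1 `]-oo, x]%classic - nu2 `]-oo, x]%classic| <=
    (D / pi + 2 * tau + 2 * c * r)%:E)%E.
Proof.
move=> hD hc x.
have fin (nu : probability (measurableTypeR R) R) y :
    nu `]-oo, y]%classic = (fine (nu `]-oo, y]%classic))%:E.
  by rewrite fineK// fin_num_measure.
have inc a b : a <= b ->
    fine (nu2 `]-oo, b]%classic) <= fine (nu2 `]-oo, a]%classic) + c * (b - a).
  move=> ab; rewrite -lee_fin EFinD -!fin.
  have -> : `]-oo, b]%classic = `]-oo, a]%classic `|` `]a, b]%classic :> set R.
    by rewrite -itv_bndbnd_setU// bnd_simp.
  apply: le_trans (measureU2 _ _ _) _ => //.
  by apply: leeD => //; exact: hc.
have hK y : `|\int[nu1]_u cauchy_cdf (y - u) - \int[nu2]_u cauchy_cdf (y - u)|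
    <= D / pi.
  rewrite !cauchy_cdf_integral opprD addrACA subrr add0r -mulrBl normrM.
  by rewrite (gtr0_norm (_ : 0 < pi^-1)) ?invr_gt0// ler_wpM2r// invr_ge0 ltW.
rewrite fin (fin nu2) -EFinB lee_fin ler_norml.
have u1 := cdf_le_smoothed nu1 x; have l1 := smoothed_le_cdf nu1 x.
have := smoothed_le_cdf nu2 (x + 2 * r).
have -> : x + 2 * r - r = x + r by ring.
have := cdf_le_smoothed nu2 (x - 2 * r).
have -> : x - 2 * r + r = x - r by ring.
have i1 : x - 2 * r <= x by rewrite lerBlDr lerDl mulr_ge0 ?ltW.
have i2 : x <= x + 2 * r by rewrite lerDl mulr_ge0 ?ltW.
move: (inc _ _ i1) (inc _ _ i2) (hK (x - r)) (hK (x + r)).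
rewrite !ler_norml => a1 a2 /andP[a3 a4] /andP[a5 a6] a7 a8.
apply/andP; split; lra.
Qed.

End unsmoothing.

(** * Explicit integrals and numerical bounds *)

Section explicit_integrals.
Context {R : realType}.
Notation leb := (@lebesgue_measure R).
Notation D := (`]0%R, +oo[%classic : set R).

Lemma continuous_cubic_gauss : continuous (fun t : R => t ^+ 3 * expR (- (t ^+ 2 / 4))).
Proof.
apply: (@is_derive_continuous _ _ (fun t : R =>
  3 * t ^+ 2 * expR (- (t ^+ 2 / 4)) - t ^+ 3 * (t / 2) * expR (- (t ^+ 2 / 4)))) => t.
by derive_eq; rewrite /=; field.
Qed.

Lemma integral_cubic_gauss :
  (\int[leb]_(t in `[0%R, +oo[) (t ^+ 3 * expR (- (t ^+ 2 / 4)))%:E = 8%:E)%E.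
Proof.
pose F (t : R) := - ((2 * t ^+ 2 + 8) * expR (- (t ^+ 2 / 4))).
have dF (t : R) : is_derive t (1 : R) F (t ^+ 3 * expR (- (t ^+ 2 / 4))).
  by rewrite /F; derive_eq; rewrite /=; field.
have cF := is_derive_continuous dF.
have F_bound (t : R) : 1 <= t -> `|F t| <= 16 * expR (- (1 / 8 * t)).
  move=> t1; have t2 : t <= t ^+ 2 by rewrite expr2; nra.
  have e1 : expR (- (t ^+ 2 / 4)) = expR (- (t ^+ 2 / 8)) * expR (- (t ^+ 2 / 8)).
    by rewrite -expRD; congr expR; field.
  have e2 : expR (- (t ^+ 2 / 8)) <= expR (- (1 / 8 * t)) by rewrite ler_expR; lra.
  have e3 : (1 + t ^+ 2 / 8) * expR (- (t ^+ 2 / 8)) <= 1.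
    rewrite -[leRHS](expRxMexpNx_1 (t ^+ 2 / 8)) ler_wpM2r ?expR_ge0//.
    exact: expR_ge1Dx.
  have e0 := expR_ge0 (- (t ^+ 2 / 8)).
  rewrite /F normrN ger0_norm ?mulr_ge0 ?expR_ge0//; last first.
    by have := sqr_ge0 t; lra.
  rewrite e1 mulrA (le_trans _ (ler_wpM2l _ e2))// ler_wpM2r//.
  rewrite mulrDl; have := sqr_ge0 t; nra.
rewrite (@ge0_continuous_FTC2y _ _ F 0 0).
- by rewrite -EFinB; congr EFin; rewrite /F expr0n/= mul0r oppr0 expR0; ring.
- by move=> t t0; rewrite mulr_ge0 ?expR_ge0// exprn_ge0.
- by apply: continuous_subspaceT; exact: continuous_cubic_gauss.
- have e0 : 16 * expR (- (1 / 8 * t)) @[t --> +oo] --> (0 : R).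
    rewrite -[X in _ --> X](mulr0 16); apply: cvgM; first exact: cvg_cst.
    apply: (cvg_comp (fun t : R => 1 / 8 * t) (fun x => expR (- x)) _ (@cvgr_expR R)).
    by apply: (gt0_cvgMry _ cvg_id); lra.
  apply: (@squeeze_cvgr _ _ _ _ (fun t => - (16 * expR (- (1 / 8 * t))))
    (fun t => 16 * expR (- (1 / 8 * t)))) => //.
  + near=> t; rewrite -ler_norml; apply: F_bound.
    by near: t; exact: nbhs_pinfty_ge.
  + by rewrite -oppr0; apply: cvgN.
- by move=> t _; have [] := dF t.
- by apply: cvg_at_right_filter; exact: cF.
- by move=> t _; rewrite derive1E; have [] := dF t.
Unshelve. all: by end_near. Qed.

Lemma integrable_cubic_gauss :
  leb.-integrable D (EFin \o (fun t : R => t ^+ 3 * expR (- (t ^+ 2 / 4)))).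
Proof.
have i0 : leb.-integrable `[0%R, +oo[ (EFin \o (fun t : R => t ^+ 3 * expR (- (t ^+ 2 / 4)))).
  apply/integrableP; split.
    apply/measurable_EFinP/measurable_funTS.
    exact: continuous_measurable_fun continuous_cubic_gauss.
  rewrite (_ : (\int[leb]_(t in _) _)%E = 8%:E) ?ltry//.
  rewrite -integral_cubic_gauss; apply: eq_integral => t.
  rewrite inE/= in_itv/= andbT => t0.
  by rewrite ger0_norm// mulr_ge0 ?expR_ge0// exprn_ge0.
apply: integrableS i0 => //.
by move=> t /=; rewrite !in_itv/= !andbT; exact: ltW.
Qed.

Lemma Rintegral_cubic_gauss :
  \int[leb]_(t in D) (t ^+ 3 * expR (- (t ^+ 2 / 4))) = 8.
Proof.
rewrite Rintegral_itv_obnd_cbnd; last exact: integrable_cubic_gauss.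
by rewrite /Rintegral integral_cubic_gauss.
Qed.

Section inverse_square.
Variables (d : R) (d0 : 0 < d).

Let inv2 (t : R) := t ^- 2.

Let d_inv (t : R) : 0 < t -> is_derive t (1 : R) (fun t => - t^-1) (inv2 t).
Proof.
move=> t0; apply: (is_derive_congr (drv_N (drv_inv (lt0r_neq0 t0) (drv_id t)))).
by rewrite mulr1 opprK.
Qed.

Let c_inv2 (t : R) : 0 < t -> {for t, continuous inv2}.
Proof.
move=> t0; apply: (@continuous_comp _ _ _ (fun t : R => t ^+ 2) GRing.inv).
  exact: exprn_continuous.
by apply: inv_continuous; rewrite expf_eq0/= gt_eqF.
Qed.

Let within_inv2 : {within `[d, +oo[, continuous inv2}.
Proof.
apply: continuous_in_subspaceT => t; rewrite inE/= in_itv/= andbT => dt.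
exact/c_inv2/(lt_le_trans d0).
Qed.

Lemma integral_inverse_square :
  (\int[leb]_(t in `[d, +oo[) (t ^- 2)%:E = (d^-1)%:E)%E.
Proof.
rewrite (@ge0_continuous_FTC2y _ inv2 (fun t => - t^-1) d 0).
- by rewrite -EFinB sub0r opprK.
- by move=> t _; rewrite /inv2 invr_ge0 sqr_ge0.
- exact: within_inv2.
- apply/cvgr0Pnorm_le => e e0; near=> t.
  have t0 : 0 < t by near: t; exact: nbhs_pinfty_gt.
  have te : e^-1 <= t by near: t; exact: nbhs_pinfty_ge (num_real _).
  rewrite normrN (gtr0_norm (_ : 0 < t^-1)) ?invr_gt0//.
  by rewrite -[e]invrK lef_pV2 ?posrE ?invr_gt0.
- by move=> t dt; have [] := d_inv (lt_trans d0 dt).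
- apply: cvg_at_right_filter; apply: cvgN; apply: inv_continuous.
  by rewrite gt_eqF.
- move=> t; rewrite in_itv/= andbT => dt.
  by rewrite derive1E; have [] := d_inv (lt_trans d0 dt).
Unshelve. all: by end_near. Qed.

Let iinv : leb.-integrable `[d, +oo[ (EFin \o (fun t : R => t ^- 2)).
Proof.
apply/integrableP; split.
  apply/measurable_EFinP.
  exact: (subspace_continuous_measurable_fun _ within_inv2).
under eq_integral do rewrite /= ger0_norm ?invr_ge0 ?sqr_ge0//.
by rewrite integral_inverse_square ltry.
Qed.

Notation tail := ((fun t : R => t ^- 2) \_ `[d, +oo[%classic).

Let Dd : D `&` `[d, +oo[%classic = `[d, +oo[%classic.
Proof.
apply/setIidr => t /=; rewrite !in_itv/= !andbT; exact: lt_le_trans.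
Qed.

Lemma integrable_inverse_square_tail : leb.-integrable D (EFin \o tail).
Proof.
rewrite -restrict_EFin; apply/integrable_restrict => //.
by rewrite Dd.
Qed.

Lemma Rintegral_inverse_square_tail : \int[leb]_(t in D) tail t = d^-1.
Proof.
by rewrite -Rintegral_mkcondr Dd /Rintegral integral_inverse_square.
Qed.

End inverse_square.

End explicit_integrals.

Section numerical_bounds.
Context {R : realType}.

(** It is enough that exp (- 1 / 2) >= 1 / 2. *)
Lemma expR2_le16 : expR 2 <= 16 :> R.
Proof.
have h := expR_ge1Dx (- (1 / 2) : R).
have e : expR (- (1 / 2)) ^+ 4 * expR 2 = 1 :> R.
  by rewrite -expRM_natl -expRD -expR0; congr expR; field.
have h4 : 1 / 16 <= expR (- (1 / 2)) ^+ 4 :> R.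
  rewrite (_ : 1 / 16 = (1 / 2) ^+ 4 :> R); last by field.
  by apply: lerXn2r; rewrite ?nnegrE ?expR_ge0//; lra.
have := ler_wpM2r (expR_ge0 2) h4; rewrite e; lra.
Qed.

(** Since (n+4)! >= 24 (n+1)!, the left side for n + 1 is at most exp (t) /
    4, and t <= 2 + t^2 / 8. This trades the unbounded degree k for the fixed
    degree 3 in the low frequency integral. *)
Lemma pow_div_fact_le (t : R) n : 0 <= t ->
  t ^+ n * 6 / (n + 3)`!%:R <= 4 * expR (t ^+ 2 / 8).
Proof.
move=> t0; have e1 : 1 <= expR (t ^+ 2 / 8) by rewrite -expR0 ler_expR divr_ge0 ?sqr_ge0.
case: n => [|n]; first by rewrite expr0 mul1r add0n -[3`!]/6%N; lra.
have f0 : 0 < n.+1`!%:R :> R by rewrite ltr0n fact_gt0.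
have h1 : t ^+ n.+1 * 6 / (n.+1 + 3)`!%:R <= t ^+ n.+1 / n.+1`!%:R / 4.
  have : 24 * n.+1`!%:R <= (n.+1 + 3)`!%:R :> R.
    rewrite -natrM ler_nat !addSn addn3 !factS.
    rewrite !mulnA leq_mul2r; apply/orP; right.
    by rewrite -[24%N]/(4 * 3 * 2)%N !leq_mul.
  have tn := exprn_ge0 n.+1 t0.
  have g0 : 0 < (n.+1 + 3)`!%:R :> R by rewrite ltr0n fact_gt0.
  move=> h; rewrite ler_pdivrMr// mulrAC -mulrA.
  rewrite [leRHS](_ : _ = t ^+ n.+1 * ((n.+1 + 3)`!%:R / (4 * n.+1`!%:R))); last first.
    by field; rewrite gt_eqF.
  rewrite ler_wpM2l// ler_pdivlMr ?mulr_gt0//; lra.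
apply: le_trans h1 _.
have h2 : t ^+ n.+1 / n.+1`!%:R <= expR t.
  by rewrite ler_pdivrMr// mulrC pow_le_fact_expR.
have h3 : expR t <= expR 2 * expR (t ^+ 2 / 8).
  by rewrite -expRD ler_expR; have := sqr_ge0 (t - 4); lra.
have h4 := ler_wpM2r (expR_ge0 (t ^+ 2 / 8)) expR2_le16.
lra.
Qed.

End numerical_bounds.

(** * The distance of the distribution functions *)

Section characteristic_function_bounds.
Context {R : realType} (mu : probability (measurableTypeR R) R) (k N : nat).
Notation gauss := (@normal_prob R 0 1).
Notation M := (\int[mu]_x `|x| ^+ k.+1).
Notation rN := (Num.sqrt (N%:R : R)).
Hypothesis k3 : (3 <= k)%N.
Hypothesis intk : mu.-integrable setT (EFin \o (fun x : R => `|x| ^+ k.+1)).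
Hypothesis moments : forall j, (1 <= j <= k)%N ->
  \int[mu]_x x ^+ j = \int[gauss]_u u ^+ j.

(** Telescoping ([polar_power_diff]) with the bounds of [phase_cf_gauss_diff]
    and [phase_cf_low] at s = t / sqrt N. For N >= 8 the exponent 11 / 24
    times N - 1 is at least 2 / 5 times N. *)
Lemma cf_power_low (t rho phi : R) : (8 <= N)%N -> 0 < t -> t ^+ 2 * M <= N%:R ->
  0 <= rho -> (forall th, phase_cf mu id th (t / rN) = rho * cos (th + phi)) ->
  forall th, `|rho ^+ N * cos (th + N%:R * phi) - cos th * expR (- (t ^+ 2 / 2))| <=
    M / rN ^+ k.-1 * (t ^+ k.+1 / k`!%:R) * expR (- (2 / 5 * t ^+ 2)).
Proof.
move=> N8 t0 tM rho0 cf th.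
have Npos : 0 < N%:R :> R by rewrite ltr0n (leq_trans _ N8).
have N8' : 8 <= N%:R :> R by rewrite ler_nat.
have rpos : 0 < rN by rewrite sqrtr_gt0.
have rN2 : rN ^+ 2 = N%:R by rewrite sqr_sqrtr// ltW.
pose s := t / rN.
have s0 : 0 < s by rewrite divr_gt0.
have s2 : N%:R * s ^+ 2 = t ^+ 2.
  by rewrite /s exprMn exprVn rN2 mulrCA divff ?mulr1// gt_eqF.
have M1 := matched_abs_moment_ge1 k3 intk moments.
have sM : s ^+ 2 * M <= 1.
  by rewrite -(ler_pM2l Npos) mulr1 mulrA s2.
have rhoq : rho <= expR (- (11 / 24 * s ^+ 2)).
  have := phase_cf_low k3 intk moments (- phi) sM.
  rewrite cf addNr cos0 mulr1 (ger0_norm rho0) => h.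
  by rewrite (le_trans h)// (le_trans _ (expR_ge1Dx _)).
have rq : expR (- (s ^+ 2 / 2)) <= expR (- (11 / 24 * s ^+ 2)).
  by rewrite ler_expR; have := sqr_ge0 s; lra.
have he th' : `|rho * cos (th' + phi) - expR (- (s ^+ 2 / 2)) * cos th'| <=
    s ^+ k.+1 * M / k`!%:R.
  rewrite -cf (mulrC (expR _)) -[in leRHS](gtr0_norm s0).
  exact: phase_cf_gauss_diff.
have := polar_power_diff N rho0 (expR_ge0 _) rhoq rq he th.
have -> : expR (- (s ^+ 2 / 2)) ^+ N = expR (- (t ^+ 2 / 2)).
  by rewrite -expRM_natl; congr expR; rewrite -s2; ring.
rewrite (mulrC (expR (- (t ^+ 2 / 2)))) => h; apply: le_trans h _.
have f0 : 0 < k`!%:R :> R by rewrite ltr0n fact_gt0.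
have E : N%:R * (s ^+ k.+1 * M / k`!%:R) = M / rN ^+ k.-1 * (t ^+ k.+1 / k`!%:R).
  have kE : k.+1 = (k.-1 + 2)%N by rewrite addn2; case: k k3.
  have -> : s ^+ k.+1 = t ^+ k.+1 / (rN ^+ k.-1 * N%:R).
    by rewrite /s exprMn exprVn [in X in _ / X]kE exprD rN2.
  field; rewrite !gt_eqF//= ?exprn_gt0//.
rewrite E; apply: ler_wpM2l.
  rewrite mulr_ge0// divr_ge0 ?exprn_ge0 ?(ltW t0) ?(ltW rpos)//.
  by rewrite (le_trans _ M1).
rewrite -expRM_natl ler_expR -s2.
have -> : N.-1%:R = N%:R - 1 :> R by rewrite -subn1 natrB// (leq_trans _ N8).
have := sqr_ge0 s; nra.
Qed.

(** Of the Gaussian factor exp (- 2 t^2 / 5), the part exp (- t^2 / 8)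
    absorbs the power t^(k-3) against k!. *)
Lemma low_integrand (t e : R) : 0 < t ->
  e <= M / rN ^+ k.-1 * (t ^+ k.+1 / k`!%:R) * expR (- (2 / 5 * t ^+ 2)) ->
  e * t^-1 <= M / rN ^+ k.-1 * (2 / 3) * (t ^+ 3 * expR (- (t ^+ 2 / 4))).
Proof.
move=> t0 he.
have M1 := matched_abs_moment_ge1 k3 intk moments.
have A0 : 0 <= M / rN ^+ k.-1.
  by rewrite divr_ge0 ?exprn_ge0 ?sqrtr_ge0// (le_trans _ M1).
apply: le_trans (ler_wpM2r (_ : 0 <= t^-1) he) _; first by rewrite invr_ge0 ltW.
move: A0; move: (M / _) => A A0.
rewrite -[leRHS](mulrA A) -[leLHS](mulrA (A * _)) -[leLHS](mulrA A).
apply: ler_wpM2l => //; rewrite mulrA.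
have kE : k = (k - 3 + 3)%N by rewrite subnK.
have h := pow_div_fact_le (k - 3) (ltW t0); rewrite -kE in h.
have -> : t ^+ k.+1 / k`!%:R * expR (- (2 / 5 * t ^+ 2)) * t^-1 =
   (t ^+ (k - 3) * 6 / k`!%:R) * (t ^+ 3 / 6 * expR (- (2 / 5 * t ^+ 2))).
  have -> : t ^+ k.+1 = t ^+ (k - 3) * t ^+ 3 * t by rewrite -exprD -kE exprSr.
  have fk0 : k`!%:R != 0 :> R by rewrite pnatr_eq0 -lt0n fact_gt0.
  by move: (t ^+ (k - 3)) (expR _) (k`!%:R) fk0 => a b c c0; field; rewrite c0 gt_eqF.
have t3 : 0 <= t ^+ 3 / 6 * expR (- (2 / 5 * t ^+ 2)).
  by rewrite mulr_ge0 ?expR_ge0// divr_ge0// exprn_ge0// ltW.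
apply: le_trans (ler_wpM2r t3 h) _.
have -> : 4 * expR (t ^+ 2 / 8) * (t ^+ 3 / 6 * expR (- (2 / 5 * t ^+ 2))) =
   2 / 3 * (t ^+ 3 * (expR (t ^+ 2 / 8) * expR (- (2 / 5 * t ^+ 2)))) by field.
rewrite -expRD ler_wpM2l// ler_wpM2l ?exprn_ge0 ?(ltW t0)//.
by rewrite ler_expR; have := sqr_ge0 t; lra.
Qed.

Variables (h w : R).
Hypotheses (h0 : 0 < h) (w01 : 0 < w <= 1).
Hypothesis A1 : assumption1 h w mu.

Notation L := (h * w ^+ 3 * N%:R / M).

(** At s >= 1 / sqrt M the bound [phase_cf_high] applies with s0 = 1 / sqrt
    M. *)
Lemma cf_power_high (t rho phi : R) : (1 <= N)%N -> 0 < t -> N%:R <= t ^+ 2 * M ->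
  0 <= rho -> (forall th, phase_cf mu id th (t / rN) = rho * cos (th + phi)) ->
  rho ^+ N <= expR (- (L / 48)).
Proof.
move=> N1 t0 tM rho0 cf.
have Npos : 0 < N%:R :> R by rewrite ltr0n.
have rpos : 0 < rN by rewrite sqrtr_gt0.
have M1 := matched_abs_moment_ge1 k3 intk moments.
have Mpos : 0 < M by rewrite (lt_le_trans _ M1).
have s01 : 0 < (Num.sqrt M)^-1 <= 1.
  rewrite invr_gt0 sqrtr_gt0 Mpos/= invf_le1 ?sqrtr_gt0//.
  by rewrite -(ler_sqr) ?nnegrE ?sqrtr_ge0// expr1n sqr_sqrtr// ltW.
have s0s : (Num.sqrt M)^-1 <= t / rN.
  rewrite ler_pdivlMr// mulrC ler_pdivrMr ?sqrtr_gt0//.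
  rewrite -ler_sqr ?nnegrE ?mulr_ge0 ?sqrtr_ge0 ?(ltW t0)//.
  by rewrite exprMn !sqr_sqrtr ?(ltW Npos) ?(ltW Mpos).
have := phase_cf_high (- phi) h0 w01 A1 s01 s0s.
rewrite cf addNr cos0 mulr1 exprVn sqr_sqrtr ?(ltW Mpos)// => hr.
have -> : expR (- (L / 48)) = expR (- (h * w ^+ 3 / M / 48)) ^+ N.
  by rewrite -expRM_natl; congr expR; field; rewrite gt_eqF.
apply: lerXn2r; rewrite ?nnegrE ?expR_ge0//.
by rewrite (le_trans hr)// (le_trans _ (expR_ge1Dx _)).
Qed.

End characteristic_function_bounds.

Section distribution_function_bound.
Context {R : realType} (mu nu : probability (measurableTypeR R) R) (k N : nat).
Notation leb := (@lebesgue_measure R).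
Notation gauss := (@normal_prob R 0 1).
Notation D := (`]0%R, +oo[%classic : set R).
Notation M := (\int[mu]_x `|x| ^+ k.+1).
Notation rN := (Num.sqrt (N%:R : R)).
Hypothesis k3 : (3 <= k)%N.
Hypothesis intk : mu.-integrable setT (EFin \o (fun x : R => `|x| ^+ k.+1)).
Hypothesis moments : forall j, (1 <= j <= k)%N ->
  \int[mu]_x x ^+ j = \int[gauss]_u u ^+ j.
Variables (h w : R).
Hypotheses (h01 : 0 < h <= 1) (w01 : 0 < w <= 1).
Hypothesis A1 : assumption1 h w mu.
Hypothesis N1 : (1 <= N)%N.
Hypothesis inu : nu.-integrable setT (EFin \o (fun u : R => `|u|)).
Hypothesis nu_cf : forall t rho phi : R,
  (forall th, phase_cf mu id th (t / rN) = rho * cos (th + phi)) ->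
  forall th, phase_cf nu id th t = rho ^+ N * cos (th + N%:R * phi).

Notation L := (h * w ^+ 3 * N%:R / M).
Notation E := (expR (- (1 / 160 * L))).

Let Npos : 0 < N%:R :> R. Proof. by rewrite ltr0n. Qed.
Let M1 : 1 <= M. Proof. exact: matched_abs_moment_ge1 k3 intk moments. Qed.
Let Mpos : 0 < M. Proof. exact: lt_le_trans M1. Qed.
Let hw1 : 0 < h * w ^+ 3 <= 1.
Proof.
case/andP: h01 => h0 h1; case/andP: w01 => w0 w1.
rewrite mulr_gt0 ?exprn_gt0//=; apply: mulr_ile1 => //.
- exact: ltW.
- by rewrite exprn_ge0// ltW.
- by rewrite exprn_ile1// ltW.
Qed.
Let Lpos : 0 < L.
Proof. by case/andP: hw1 => hw _; exact: divr_gt0 (mulr_gt0 hw Npos) Mpos. Qed.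
Let L_le : L <= N%:R / M.
Proof.
case/andP: hw1 => hw hwle; rewrite ler_wpM2r ?invr_ge0 ?(ltW Mpos)//.
by rewrite ler_piMl ?(ltW Npos).
Qed.

(** With del = sqrt (N / M) the boundary between low and high frequencies,
    the choice sig = E^2 / del and r = E / del makes the Cauchy tail, the
    Gaussian increment and the high frequency integral all of order E. The
    low frequencies contribute (16 / 3) (M / rN^(k-1)) before division by pi
    >= 2. *)
Lemma cdf_bound_of_small_error : E < 1 / 3 ->
  forall x, (`|nu `]-oo, x]%classic - gauss `]-oo, x]%classic| <=
    (3 * (M / rN ^+ k.-1 + E))%:E)%E.
Proof.
move=> E3.
(* 1 - L / 160 <= E < 1 / 3 *)
have L106 : 106 <= L.
  have := le_lt_trans (expR_ge1Dx (- (1 / 160 * L))) E3; lra.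
have NM : 106 <= N%:R / M := le_trans L106 L_le.
have N106 : 106 * M <= N%:R by rewrite -ler_pdivlMr.
have N8 : (8 <= N)%N by rewrite -(ler_nat R); have := M1; lra.
have Epos : 0 < E := expR_gt0 _.
pose del := Num.sqrt (N%:R / M).
have del2 : del ^+ 2 = N%:R / M by rewrite sqr_sqrtr// (le_trans _ NM).
have del1 : 1 <= del.
  by rewrite -ler_sqr ?nnegrE ?sqrtr_ge0// expr1n del2 (le_trans _ NM)//; lra.
have dpos : 0 < del by rewrite (lt_le_trans _ del1).
pose sig := E ^+ 2 / del.
have sig0 : 0 < sig by rewrite divr_gt0 ?exprn_gt0.
pose r := E / del.
have r0 : 0 < r by rewrite divr_gt0.
pose A := M / rN ^+ k.-1.
have A0 : 0 <= A by rewrite divr_ge0 ?exprn_ge0 ?sqrtr_ge0 ?(ltW Mpos).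
pose tail : R -> R := (fun t => t ^- 2) \_ `[del, +oo[%classic.
pose G (t : R) := A * (2 / 3) * (t ^+ 3 * expR (- (t ^+ 2 / 4))) +
  2 * E ^+ 3 / sig * tail t.
have iG1 := @integrable_cubic_gauss R.
have iG2 : leb.-integrable D (EFin \o tail) by exact: integrable_inverse_square_tail.
have iG : leb.-integrable D (EFin \o G).
  by apply: rintegrableD => //; exact: rintegrableZl.
have intG : \int[leb]_(t in D) G t <= 16 / 3 * A + 2 * E.
  rewrite RintegralD//; [|exact: rintegrableZl|exact: rintegrableZl].
  rewrite !RintegralZl// Rintegral_cubic_gauss Rintegral_inverse_square_tail//.
  have -> : 2 * E ^+ 3 / sig / del = 2 * E.
    by rewrite /sig; field; rewrite !gt_eqF.
  lra.
(* As 3 / 160 <= 1 / 48, three factors E fit below the high frequency bound;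
   dividing by sig, of order E^2, uses up two of them. *)
have E3L (c : R) : 1 / 48 <= c -> expR (- (L * c)) <= E ^+ 3.
  move=> hc; rewrite -expRM_natl ler_expR.
  have := ler_wpM2l (ltW Lpos) hc; have := Lpos; lra.
have cfG th t : 0 < t -> `|phase_cf nu id th t - phase_cf gauss id th t| *
    sinc_kernel sig t <= G t.
  move=> t0.
  have [rho [phi [rho0 cf]]] := phase_cf_polar mu (@measurable_id _ _ setT) (t / rN).
  rewrite (nu_cf cf) phase_cf_gauss.
  have tail0 : 0 <= tail t.
    by rewrite /tail patchE; case: ifP => // _; rewrite invr_ge0 sqr_ge0.
  have e_le1 : expR (- (sig * t)) <= 1.
    by rewrite -expR0 ler_expR oppr_le0 mulr_ge0// ltW.
  have [td|td] := ltP t del.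
    have tM : t ^+ 2 * M <= N%:R.
      by rewrite -ler_pdivlMr// -del2 ler_sqr ?nnegrE ?ltW.
    have := low_integrand k3 intk moments t0
      (cf_power_low k3 intk moments N8 t0 tM rho0 cf th).
    rewrite -/A => low; rewrite /sinc_kernel mulrA.
    apply: (@le_trans _ _ (A * (2 / 3) * (t ^+ 3 * expR (- (t ^+ 2 / 4))))).
      apply: le_trans low; rewrite ler_piMr// mulr_ge0// invr_ge0 ltW//.
    by rewrite /G lerDl !mulr_ge0 ?invr_ge0 ?exprn_ge0 ?(ltW sig0) ?(ltW Epos).
  have tM : N%:R <= t ^+ 2 * M.
    by rewrite -ler_pdivrMr// -del2 ler_sqr ?nnegrE ?(ltW dpos) ?(ltW t0).
  have h0 : 0 < h by case/andP: h01.
  have hp := cf_power_high k3 intk moments h0 w01 A1 N1 t0 tM rho0 cf.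
  have hg : expR (- (t ^+ 2 / 2)) <= expR (- (L * (1 / 2))).
    have : L <= t ^+ 2 by rewrite (le_trans L_le)// ler_pdivrMr.
    by rewrite ler_expR; lra.
  have d_le : `|rho ^+ N * cos (th + N%:R * phi) - cos th * expR (- (t ^+ 2 / 2))|
      <= 2 * E ^+ 3.
    rewrite (le_trans (ler_normB _ _))// !normrM (ger0_norm (exprn_ge0 N rho0)).
    rewrite (ger0_norm (expR_ge0 _)).
    have a1 : rho ^+ N * `|cos (th + N%:R * phi)| <= E ^+ 3.
      rewrite (@le_trans _ _ (rho ^+ N))//; first by rewrite ler_piMr ?exprn_ge0// cos_max.
      by rewrite (le_trans hp)//; apply: le_trans (E3L (1 / 48) _) => //; rewrite div1r.
    have a2 : `|cos th| * expR (- (t ^+ 2 / 2)) <= E ^+ 3.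
      rewrite (@le_trans _ _ (expR (- (t ^+ 2 / 2))))//.
        by rewrite ler_piMl ?expR_ge0// cos_max.
      by rewrite (le_trans hg)// E3L//; lra.
    lra.
  have kern : sinc_kernel sig t <= (sig * t ^+ 2)^-1.
    have st : 0 < sig * t by rewrite mulr_gt0.
    have e1 : expR (- (sig * t)) <= (sig * t)^-1.
      rewrite expRN lef_pV2 ?posrE ?expR_gt0//.
      by have := expR_ge1Dx (sig * t); lra.
    rewrite /sinc_kernel (le_trans (ler_wpM2l _ e1)) ?invr_ge0 ?(ltW t0)//.
    by rewrite -invfM (_ : t * (sig * t) = sig * t ^+ 2)//; ring.
  have k0 : 0 <= sinc_kernel sig t by rewrite mulr_ge0 ?expR_ge0// invr_ge0 ltW.
  apply: le_trans (ler_pM (normr_ge0 _) k0 d_le kern) _.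
  have -> : 2 * E ^+ 3 / (sig * t ^+ 2) = 2 * E ^+ 3 / sig * tail t.
    have tin : t \in `[del, +oo[%classic by rewrite inE/= in_itv/= andbT.
    by rewrite /tail patchE tin invfM mulrA.
  rewrite /G lerDr; apply: mulr_ge0; first exact: mulr_ge0.
  exact: mulr_ge0 (exprn_ge0 _ (ltW t0)) (expR_ge0 _).
have ig : gauss.-integrable setT (EFin \o (fun u : R => `|u|)).
  by have := integrable_gauss_norm_pow (R := R) 1; under eq_fun do rewrite expr1.
have smooth x := smoothed_diff_le sig0 x inu ig iG intG cfG.
move=> x; apply: le_trans (cdf_diff_le sig0 r0 smooth (@gauss_interval_le R) x) _.
rewrite lee_fin.
have -> : sig / (pi * r) = E / pi.
  rewrite /sig /r; have := @pi_gt0 R; move: (pi : R) => p p0.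
  by field; rewrite !gt_eqF.
have re : r <= E by rewrite /r ler_pdivrMr// ler_peMr// ltW.
have pi2 : pi^-1 <= 1 / 2 :> R.
  by rewrite div1r lef_pV2 ?posrE ?pi_gt0 ?pi_ge2.
have piV : 0 <= pi^-1 :> R by rewrite invr_ge0 ltW ?pi_gt0.
have B0 : 0 <= 16 / 3 * A + 2 * E by have := A0; have := Epos; lra.
have := ler_wpM2l B0 pi2; have := ler_wpM2l (ltW Epos) pi2.
rewrite -/A; lra.
Qed.

Lemma cdf_bound x : (`|nu `]-oo, x]%classic - gauss `]-oo, x]%classic| <=
  (3 * (M / rN ^+ k.-1 + E))%:E)%E.
Proof.
have [E3|E3] := ltP E (1 / 3); first exact: cdf_bound_of_small_error.
(* Now 3 E >= 1 exceeds the distance of any two distribution functions. *)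
have A0 : 0 <= M / rN ^+ k.-1.
  by rewrite divr_ge0 ?exprn_ge0 ?sqrtr_ge0 ?(ltW Mpos).
have fin (m : probability (measurableTypeR R) R) :
    m `]-oo, x]%classic = (fine (m `]-oo, x]%classic))%:E.
  by rewrite fineK// fin_num_measure.
have f01 (m : probability (measurableTypeR R) R) :
    0 <= fine (m `]-oo, x]%classic) <= 1.
  by rewrite -!lee_fin -fin measure_ge0 probability_le1.
rewrite (fin nu) (fin gauss) -EFinB lee_fin ler_norml.
have /andP[a b] := f01 nu; have /andP[c d] := f01 gauss.
by apply/andP; split; lra.
Qed.

End distribution_function_bound.

(** * Laws of random variables and the theorem *)

Section borel_random_variable.
Context {R : realType} d {T : measurableType d} (P : probability T R).
Variable X : {RV P >-> R}.

(** The real line carries two measurable structures with the same measurable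
    sets; laws are transported to the one of Lebesgue measure. *)
Definition borel_rv : T -> measurableTypeR R := X.

Let measurable_borel_rv : measurable_fun setT borel_rv.
Proof. exact: (measurable_funPT X). Qed.

HB.instance Definition _ :=
  isMeasurableFun.Build _ _ _ _ borel_rv measurable_borel_rv.

End borel_random_variable.

Definition borel_law {R : realType} d {T : measurableType d} (P : probability T R)
  (X : {RV P >-> R}) : probability (measurableTypeR R) R :=
  distribution P (borel_rv X).

Section laws.
Context {R : realType} d {T : measurableType d} (P : probability T R).
Context (X : {RV P >-> R}).

Lemma integrable_borel_law (f : R -> R) : measurable_fun setT f ->
  (borel_law X).-integrable setT (EFin \o f) <->
  P.-integrable setT (EFin \o (fun t => f (X t))).
Proof.
move=> mf.
have mfX : measurable_fun setT (fun t => f (X t)).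
  by apply: measurableT_comp => //; exact: measurable_funPT.
have E : (\int[borel_law X]_y `|(EFin \o f) y| =
          \int[P]_t `|(EFin \o (fun t => f (X t))) t|)%E.
  rewrite ge0_integral_distribution//.
  by apply: measurableT_comp => //; exact/measurable_EFinP.
split=> /integrableP[_ h]; apply/integrableP; split; try exact/measurable_EFinP.
  by rewrite -E.
by rewrite E.
Qed.

Lemma Rintegral_borel_law (f : R -> R) : measurable_fun setT f ->
  P.-integrable setT (EFin \o (fun t => f (X t))) ->
  \int[borel_law X]_y f y = \int[P]_t f (X t).
Proof.
move=> mf iX; rewrite /Rintegral integral_distribution//.
exact/measurable_EFinP.
Qed.

Lemma phase_cf_borel_law (th t : R) :
  phase_cf (borel_law X) id th t = phase_cf P X th t.
Proof.
rewrite /phase_cf Rintegral_borel_law//.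
- by apply: (@measurable_phase _ _ _ id).
- by apply: integrable_phase; exact: measurable_funPT.
Qed.

End laws.

Lemma powR_half_pred (R : realType) (N k : nat) : (1 <= k)%N ->
  (N%:R : R) `^ ((k%:R - 1) / 2) = Num.sqrt N%:R ^+ k.-1.
Proof.
move=> k1; have -> : (k%:R - 1) / 2 = 2^-1 * k.-1%:R :> R.
  by rewrite -subn1 natrB// mulrC.
by rewrite powRrM powR12_sqrt// powR_mulrn// sqrtr_ge0.
Qed.

Theorem theorem1p1 (R : realType)
  (d0 d1 d2 : measure_display)
  (T0 : measurableType d0) (P0 : probability T0 R) (X : {RV P0 >-> R})
  (T1 : measurableType d1) (P1 : probability T1 R)
  (T2 : measurableType d2) (P2 : probability T2 R) (G : {RV P2 >-> R})
  (h w : R) (k N : nat) (Xs : 'I_N -> {RV P1 >-> R})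
  (h_bounds : 0 < h <= 1) (w_bounds : 0 < w <= 1)
  (X_assumption1 : assumption1 h w (distribution P0 X))
  (k_ge3 : (3 <= k)%N)
  (X_moments : forall j : nat, (1 <= j <= k)%N ->
    ('E_P0[(fun t => X t ^+ j)%R] =
     \int[@lebesgue_measure R]_u
      (u ^+ j * (expR (- (u ^+ 2 / 2)) / Num.sqrt (2 * pi)))%:E)%E)
  (X_finite_moment : ('E_P0[(fun t => `|X t| ^+ k.+1)%R] < +oo)%E)
  (N_ge1 : (1 <= N)%N)
  (Xs_independent : mutually_independent P1 Xs)
  (Xs_law : forall i, has_law P1 (Xs i) (distribution P0 X))
  (G_law : has_law P2 G (normal_prob 0 1)) :
  let M := fine ('E_P0[(fun t => `|X t| ^+ k.+1)%R])%E in
  (dKS P1 P2 (normalized_sum P1 Xs) G <=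
    (3 * (M / (N%:R `^ ((k%:R - 1) / 2))
          + expR (- (1 / 160 * (h * w ^+ 3 * N%:R / M)))))%:E)%E.
Proof.
cbv zeta; set M := fine _.
pose mu := borel_law (P := P0) X; pose nu := borel_law (P := P1) (normalized_sum P1 Xs).
have mX : measurable_fun setT X := measurable_funPT X.
have iXk : P0.-integrable setT (EFin \o (fun t => `|X t| ^+ k.+1)).
  apply/integrableP; split.
    apply/measurable_EFinP; apply: measurable_funX.
    by apply: measurableT_comp => //; exact: normr_measurable.
  move: X_finite_moment; rewrite unlock; apply: le_lt_trans.
  by under eq_integral do rewrite /= ger0_norm ?exprn_ge0//.
have intk : mu.-integrable setT (EFin \o (fun x : R => `|x| ^+ k.+1)).
  exact/(integrable_borel_law _ (@measurable_norm_pow R k.+1)).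
have ME : M = \int[mu]_x `|x| ^+ k.+1.
  rewrite /mu Rintegral_borel_law//; last exact: measurable_norm_pow.
  by rewrite /M unlock.
have moments j : (1 <= j <= k)%N ->
    \int[mu]_x x ^+ j = \int[@normal_prob R 0 1]_u u ^+ j.
  move=> jk; have jk' : (j <= k.+1)%N by rewrite leqW//; case/andP: jk.
  rewrite /mu Rintegral_borel_law; first last.
  - exact/(integrable_borel_law X (@measurable_exp R j))/(integrable_pow intk).
  - exact: measurable_exp.
  have [A hA] := pow_le_quarter (R := R) j.
  rewrite (@Rintegral_gauss _ _ A); first last.
  - by move=> u; rewrite normrX.
  - exact: measurable_exp.
  by have := X_moments j jk; rewrite unlock /Rintegral /gauss_density => ->.
have int1 : mu.-integrable setT (EFin \o (fun x : R => `|x| ^+ 1)).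
  exact: (integrable_norm_pow intk).
have same_int i (f : R -> \bar R) : (\int[borel_law (Xs i)]_x f x =
    \int[mu]_x f x)%E.
  by apply: eq_measure_integral => B mB _; exact: Xs_law.
have iXs i : P1.-integrable setT (EFin \o (fun t => Xs i t)).
  apply/(integrable_borel_law (Xs i) (f := id)) => //.
  apply/integrableP; split; first exact/measurable_EFinP.
  rewrite same_int; have /integrableP[_] := int1.
  by under eq_integral do rewrite /= expr1 normr_id.
have inu : nu.-integrable setT (EFin \o (fun u : R => `|u|)).
  apply/(integrable_borel_law _ (@normr_measurable R setT)).
  apply: (@integrable_norm _ _ _ P1 setT (normalized_sum P1 Xs)).
  apply: rintegrableZr => //.
  have := integrable_sum measurableT (index_enum 'I_N) (P := xpredT) (fun i _ => iXs i).
  by apply: eq_integrable => // x _ /=; rewrite sumEFin.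
have nu_cf (t rho phi : R) :
    (forall th, phase_cf mu id th (t / Num.sqrt N%:R) = rho * cos (th + phi)) ->
    forall th, phase_cf nu id th t = rho ^+ N * cos (th + N%:R * phi).
  move=> cf th; rewrite /nu phase_cf_borel_law.
  rewrite -(phase_cf_sum (t := t / Num.sqrt N%:R) Xs_independent) => [|i th'].
    by apply: eq_Rintegral => x _; congr (cos (_ + _)); rewrite /normalized_sum mulrAC mulrA.
  rewrite -cf -phase_cf_borel_law; congr fine; exact: same_int.
apply: ge_ereal_sup => _ [s _ <-].
rewrite powR_half_pred ?(leq_trans _ k_ge3)// ME /cdf.
have -> : distribution P2 G `]-oo, s]%classic = normal_prob 0 1 `]-oo, s]%classic.
  exact: G_law.
exact: (cdf_bound k_ge3 intk moments h_bounds w_bounds X_assumption1 N_ge1 inu nu_cf).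
Qed.
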